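(* Let $V$ be a $4$-dimensional complex vector space and let $\mathcal{N}\subset \mathrm{Hom}(V\otimes V,V)\cong\mathbb{C}^{64}$ be the variety of all nilpotent $\mathfrak{CD}$-algebra structures on $V$. Then $\mathcal{N}$ has exactly $2$ irreducible components: $$\overline{\bigcup_{\lambda,\alpha,\beta,\gamma\in\mathbb{C}} O\big(\mathfrak{CD}^4_{112}(\lambda,\alpha,\beta,\gamma)\big)},\quad\text{of dimension } 18,$$ and $$\overline{\bigcup_{\lambda,\alpha\in\mathbb{C}} O\big(\mathfrak{CD}^4_{12}(\alpha,\lambda)\big)},\quad\text{of dimension } 15.$$ Here $O(\cdot)$ denotes the $\mathrm{GL}(V)$-orbit, the bar denotes Zariski closure, and the two families are given, in a basis $e_1,e_2,e_3,e_4$ of $V$ (products of basis elements not listed are zero), by $$\mathfrak{CD}^4_{112}(\lambda,\alpha,\beta,\gamma):\quad e_1e_1=\lambda e_3+e_4,\ \ e_1e_3=\alpha e_4,\ \ e_2e_1=e_3+\beta e_4,\ \ e_2e_2=e_3,\ \ e_2e_3=\gamma e_4,\ \ e_3e_3=e_4;$$ $$\mathfrak{CD}^4_{12}(\alpha,\lambda):\quad e_1e_1=e_2,\ \ e_1e_2=e_3,\ \ e_1e_3=(\lambda-2)e_4,\ \ e_2e_1=\lambda e_3,\ \ e_2e_2=\alpha e_4,\ \ e_3e_1=(1-2\lambda)e_4.$$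
   Context: All algebras are over $\mathbb{C}$ and are not assumed associative, commutative, anticommutative or unital. For an algebra $A$ and $x\in A$ let $L_x(z)=xz$ and $R_x(z)=zx$ be the left and right multiplication operators. $A$ is a $\mathfrak{CD}$-algebra if the commutator of any pair of multiplication operators is a derivation of $A$, i.e. $[L_x,L_y]$, $[L_x,R_y]$ and $[R_x,R_y]$ are derivations of $A$ for all $x,y\in A$. An algebra $A$ is nilpotent if there is $n\geq 1$ such that $A^n=0$, where $A^1=A$ and $A^{n}=\sum_{i=1}^{n-1}A^iA^{n-i}$ (equivalently, all products of $n$ elements of $A$, with any arrangement of brackets, vanish for some $n$). For an $n$-dimensional complex vector space $V$ with a fixed basis $e_1,\dots,e_n$, an algebra structure $\mu\in\mathrm{Hom}(V\otimes V,V)$ is identified with its structure constants $(c_{i,j}^k)\in\mathbb{C}^{n^3}$, $\mu(e_i\otimes e_j)=\sum_k c_{i,j}^k e_k$, and $\mathrm{Hom}(V\otimes V,V)$ carries the Zariski topology of $\mathbb{C}^{n^3}$. The group $\mathrm{GL}(V)$ acts by $(g*\mu)(x\otimes y)=g\mu(g^{-1}x\otimes g^{-1}y)$; $O(\mu)$ is the orbit of $\mu$, so orbits correspond to isomorphism classes of algebras. If an algebra $A$ is represented by a structure $\mu$, write $O(A)=O(\mu)$. An irreducible component is a maximal irreducible closed subset. *)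

(* Defs.v *)
From HB Require Import structures.
From mathcomp Require Import all_boot all_order all_algebra.
From mathcomp Require Import boolp classical_sets topology_structure.
From mathcomp Require Import mpoly.

Set Implicit Arguments.
Unset Strict Implicit.
Unset Printing Implicit Defensive.

Import GRing.Theory.
Local Open Scope ring_scope.
Local Open Scope classical_set_scope.

(* The affine space K^I with its Zariski topology. A polynomial in variables  *)
(* indexed by I is an element of {mpoly K[#|I|]}, its i-th variable standing  *)
(* for the coordinate enum_val i.                                             *)
Definition affine (K : fieldType) (I : finType) := {ffun I -> K}.

HB.instance Definition _ (K : fieldType) (I : finType) :=
  Choice.on (affine K I).

Section Zariski.
Variables (K : fieldType) (I : finType).
Implicit Types (x : affine K I) (p q : {mpoly K[#|I|]}).

Definition evalp p x : K := p.@[fun i : 'I_#|I| => x (enum_val i)].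

Definition zero_locus (P : set {mpoly K[#|I|]}) : set (affine K I) :=
  [set x | forall p, P p -> evalp p x = 0].

Definition zariski_open (U : set (affine K I)) :=
  exists P : set {mpoly K[#|I|]}, ~` U = zero_locus P.

Lemma zariski_openT : zariski_open setT.
Proof.
exists [set 1]; rewrite setCT; apply/esym; rewrite -subset0 => x /(_ 1 erefl).
by move/eqP; rewrite /evalp meval1 oner_eq0.
Qed.

Lemma zariski_openI : setI_closed zariski_open.
Proof.
move=> A B [P PE] [Q QE].
exists [set r | exists p q, [/\ P p, Q q & r = p * q]].
rewrite setCI PE QE; apply/seteqP; split=> x.
- by case=> Hx _ [p [q [Pp Qq ->]]]; rewrite /evalp mevalM;
    [rewrite [X in X * _](Hx p Pp) mul0r|rewrite [X in _ * X](Hx q Qq) mulr0].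
- move=> Hx; have [|/existsNP[p /not_implyP[Pp px]]] := pselect (zero_locus P x).
    by left.
  right=> q Qq; have /eqP : evalp (p * q) x = 0 by apply: Hx; exists p, q.
  by rewrite /evalp mevalM mulf_eq0 => /orP[] /eqP.
Qed.

Lemma zariski_open_bigU (J : Type) (f : J -> set (affine K I)) :
  (forall j, zariski_open (f j)) -> zariski_open (\bigcup_j f j).
Proof.
move=> /choice[P PE]; exists (\bigcup_j P j); rewrite setC_bigcup.
apply/seteqP; split=> x Hx.
- by move=> p [j _ Pp]; have := Hx j Logic.I; rewrite PE; apply.
- by move=> j _; rewrite PE => p Pp; apply: Hx; exists j.
Qed.

HB.instance Definition _ := isOpenTopological.Build (affine K I)
  zariski_openT zariski_openI zariski_open_bigU.

Lemma zariski_closedP (Z : set (affine K I)) :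
  closed Z <-> exists P, Z = zero_locus P.
Proof.
have openP U : @open (affine K I) U <-> zariski_open U by [].
rewrite -openC openP /zariski_open setCK; split=> -[P ZP]; by exists P.
Qed.

End Zariski.

Section Irreducible.
Variable T : topologicalType.
Implicit Types X F : set T.

(* F is closed in the subspace topology of X. *)
Definition closed_in X F := exists2 G : set T, closed G & F = X `&` G.

Definition irreducible X := X !=set0 /\
  forall F G : set T, closed F -> closed G ->
    X `<=` F `|` G -> X `<=` F \/ X `<=` G.

Definition irreducible_component X F :=
  [/\ closed_in X F, irreducible F &
      forall G, closed_in X G -> irreducible G -> F `<=` G -> G = F].

(* A chain of length m consists of the m + 1 sets F 0, ..., F m. *)
Definition irreducible_chain X (m : nat) := exists F : nat -> set T,
  (forall i, (i <= m)%N -> closed_in X (F i) /\ irreducible (F i)) /\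
  (forall i, (i < m)%N -> F i `<` F i.+1).

Definition krull_dimension X (d : nat) :=
  irreducible_chain X d /\ forall m, irreducible_chain X m -> (m <= d)%N.

End Irreducible.

(* An algebra structure on K^n is given by its structure constants: the value *)
(* at (i, j, k) is the coefficient of e_k in e_i e_j.                         *)
Definition structures (K : fieldType) (n : nat) :=
  affine K ('I_n * 'I_n * 'I_n)%type.

HB.instance Definition _ (K : fieldType) (n : nat) :=
  Topological.on (structures K n).

Section Algebras.
Variables (K : fieldType) (n : nat).
Local Notation V := 'cV[K]_n.
Implicit Types (mu nu : structures K n) (x y z : V) (U W : {vspace V}).

Definition amul mu x y : V :=
  \col_k \sum_i \sum_j x i 0 * y j 0 * mu (i, j, k).

Definition lmul mu x : V -> V := fun z => amul mu x z.
Definition rmul mu x : V -> V := fun z => amul mu z x.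

Definition commutator (f g : V -> V) : V -> V := fun z => f (g z) - g (f z).

Definition derivation mu (D : V -> V) :=
  linear D /\
  forall x y, D (amul mu x y) = amul mu (D x) y + amul mu x (D y).

Definition CD_algebra mu := forall x y,
  [/\ derivation mu (commutator (lmul mu x) (lmul mu y)),
      derivation mu (commutator (lmul mu x) (rmul mu y)) &
      derivation mu (commutator (rmul mu x) (rmul mu y))].

(* The span of all products u w with u in U and w in W. *)
Definition aprodv mu U W : {vspace V} :=
  <<[seq amul mu u w | u <- vbasis U, w <- vbasis W]>>%VS.

(* [:: A^1; ...; A^m] *)
Fixpoint apowers mu (m : nat) : seq {vspace V} :=
  if m is m'.+1 then
    let s := apowers mu m' in
    rcons s (if m' == 0%N then fullv
             else \sum_(i < m') aprodv mu (nth 0 s i) (nth 0 s (m' - i.+1)))%VS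
  else [::].

Definition apower mu (m : nat) : {vspace V} := (nth 0 (apowers mu m) m.-1)%VS.

Definition nilpotent_algebra mu :=
  exists m : nat, (0 < m)%N /\ apower mu m = 0%VS.

Definition gl_action (g : 'M[K]_n) mu : structures K n :=
  [ffun t => let: (i, j, k) := t in
     (g *m amul mu (invmx g *m delta_mx i 0) (invmx g *m delta_mx j 0)) k 0].

Definition gl_orbit mu : set (structures K n) :=
  [set nu | exists2 g : 'M[K]_n, g \in unitmx & nu = gl_action g mu].

Lemma amul_sum mu x y :
  amul mu x y = \sum_i \sum_j (x i 0 * y j 0) *: \col_k mu (i, j, k).
Proof.
apply/colP=> k; rewrite !mxE summxE; apply: eq_bigr => i _.
by rewrite summxE; apply: eq_bigr => j _; rewrite !mxE.
Qed.

Fact amul_is_linear mu x : linear (amul mu x).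
Proof.
move=> a y z; apply/colP=> k; rewrite !mxE mulr_sumr -big_split.
apply: eq_bigr => i _; rewrite mulr_sumr -big_split; apply: eq_bigr => j _ /=.
by rewrite !mxE mulrDr mulrDl !mulrA (mulrC a).
Qed.

Fact amulr_is_linear mu y : linear (amul mu ^~ y).
Proof.
move=> a x z; apply/colP=> k; rewrite !mxE mulr_sumr -big_split.
apply: eq_bigr => i _; rewrite mulr_sumr -big_split; apply: eq_bigr => j _ /=.
by rewrite !mxE !mulrDl !mulrA.
Qed.

HB.instance Definition _ mu x :=
  GRing.isLinear.Build K V V _ (amul mu x) (amul_is_linear mu x).

Lemma amul_delta mu (i j : 'I_n) :
  amul mu (delta_mx i 0) (delta_mx j 0) = \col_k mu (i, j, k).
Proof.
rewrite amul_sum (bigD1 i) //= (bigD1 j) //= !mxE !eqxx mulr1 scale1r.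
rewrite !big1 ?addr0 // => [i' /negPf ne|j' /negPf ne].
- by rewrite big1 // => j' _; rewrite !mxE ne mul0r scale0r.
- by rewrite !mxE ne mulr0 scale0r.
Qed.

Lemma amulZr mu x a y : amul mu x (a *: y) = a *: amul mu x y.
Proof. exact: linearZ. Qed.

Lemma amul_suml mu (J : finType) (a : J -> K) (u : J -> V) y :
  amul mu (\sum_j a j *: u j) y = \sum_j a j *: amul mu (u j) y.
Proof.
pose f := GRing.isLinear.Build K V V _ (amul mu ^~ y) (amulr_is_linear mu y).
pose F : {linear V -> V} := HB.pack (amul mu ^~ y) f.
by rewrite -[amul mu _ y]/(F _) linear_sum; apply: eq_bigr => j _; rewrite linearZ.
Qed.

Lemma gl_actionE (g : 'M[K]_n) mu x y :
  amul (gl_action g mu) x y = g *m amul mu (invmx g *m x) (invmx g *m y).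
Proof.
have xE (v : V) : v = \sum_i v i 0 *: delta_mx i 0.
  rewrite {1}(matrix_sum_delta v); apply: eq_bigr => i _.
  by rewrite big_ord_recl big_ord0 addr0.
have gE (v : V) : invmx g *m v = \sum_i v i 0 *: (invmx g *m delta_mx i 0).
  by rewrite {1}(xE v) mulmx_sumr; apply: eq_bigr => i _; rewrite -scalemxAr.
rewrite (gE x) (gE y) amul_sum amul_suml mulmx_sumr; apply: eq_bigr => i _.
rewrite linear_sum scaler_sumr mulmx_sumr; apply: eq_bigr => j _.
rewrite /= amulZr -!scalemxAr scalerA; congr (_ *: _).
by apply/colP=> k; rewrite mxE ffunE.
Qed.

Lemma aprodv_subP mu U W (Z : {vspace V}) :
  reflect {in U & W, forall u w, amul mu u w \in Z} (aprodv mu U W <= Z)%VS.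
Proof.
apply: (iffP span_subvP) => [sZ u w uU wW|sZ _ /allpairsP[[u w] /= [uU wW ->]]].
- rewrite (coord_vbasis uU) (coord_vbasis wW) amul_suml.
  apply: memv_suml => i _; apply: memvZ; rewrite linear_sum.
  apply: memv_suml => j _; rewrite /= amulZr; apply/memvZ/sZ/allpairs_f;
    exact/mem_nth/(leq_trans (ltn_ord _))/eq_leq/esym/size_tuple.
- by apply: sZ; apply: vbasis_mem.
Qed.

Lemma size_apowers mu m : size (apowers mu m) = m.
Proof. by elim: m => //= m IH; rewrite size_rcons IH. Qed.

Lemma nth_apowers mu m i : (i < m)%N ->
  (nth 0 (apowers mu m) i = apower mu i.+1)%VS.
Proof.
elim: m => // m IH; rewrite ltnS leq_eqVlt => /orP[/eqP->|im] //.
by rewrite /= nth_rcons size_apowers im IH.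
Qed.

Lemma apower1 mu : apower mu 1 = fullv.
Proof. by []. Qed.

Lemma apowerE mu m : (1 < m)%N ->
  (apower mu m =
     \sum_(1 <= i < m) aprodv mu (apower mu i) (apower mu (m - i)))%VS.
Proof.
case: m => [//|[//|m]] _.
rewrite {1}/apower [m.+2.-1]/= [apowers mu m.+2]/= -/(apowers mu m.+1).
rewrite nth_rcons size_apowers ltnn eqxx big_add1 big_mkord.
apply: eq_bigr => i _; rewrite !nth_apowers //; last by rewrite subSS ltnS leq_subr.
by rewrite subSS subSn // -ltnS.
Qed.

End Algebras.

Definition nilpotent_CD (K : fieldType) (n : nat) : set (structures K n) :=
  [set mu | CD_algebra mu /\ nilpotent_algebra mu].

Arguments nilpotent_CD : clear implicits.

(* Indices are shifted by one: the ordinal i of 'I_4 stands for e_(i+1).      *)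
Definition structure_of_table (K : fieldType) (c : nat -> nat -> nat -> K) :
    structures K 4 :=
  [ffun t : 'I_4 * 'I_4 * 'I_4 => let: (i, j, k) := t in c i.+1 j.+1 k.+1].

Definition CD4_112 (K : fieldType) (lambda alpha beta gamma : K) :=
  structure_of_table (fun i j k =>
    match i, j, k with
    | 1, 1, 3 => lambda
    | 1, 1, 4 => 1%R
    | 1, 3, 4 => alpha
    | 2, 1, 3 => 1%R
    | 2, 1, 4 => beta
    | 2, 2, 3 => 1%R
    | 2, 3, 4 => gamma
    | 3, 3, 4 => 1%R
    | _, _, _ => 0%R
    end%N).

Definition CD4_12 (K : fieldType) (alpha lambda : K) :=
  structure_of_table (fun i j k =>
    match i, j, k with
    | 1, 1, 2 => 1%R
    | 1, 2, 3 => 1%R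
    | 1, 3, 4 => (lambda - 2%:R)%R
    | 2, 1, 3 => lambda
    | 2, 2, 4 => alpha
    | 3, 1, 4 => (1 - 2%:R * lambda)%R
    | _, _, _ => 0%R
    end%N).

(* Main.v *)
Require Import Defs.
From mathcomp Require Import all_boot all_order all_algebra.
From mathcomp Require Import boolp classical_sets reals topology_structure complex.
From mathcomp Require Import mpoly ring zify perm.

(* Let U be the group of upper unipotent matrices, L the space of strictly    *)
(* triangular tables with e2-coefficient of e1 e1 zero (dimension 13), and F  *)
(* the tables with e_i e_j in the span of the e_k, k >= i + j, satisfying the *)
(* CD identity (a 9-dimensional cone).  A nilpotent CD-algebra has a strictly *)
(* triangular basis, and the CD identity on e1, e2, e3 then forces it into    *)
(* the GL-orbit of L or F.  Degenerating along curves shows that L and F lie  *)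
(* in the closures of the orbits of the two families; for L this uses a       *)
(* singular member of a pencil of bilinear forms.  Conversely L and F are     *)
(* stable under lower triangular matrices, so by the LU decomposition U L and *)
(* U F are dense in the two closures.  The stabilizer in U of L contains the  *)
(* (1, 2) root subgroup, so 5 + 13 = 18 and 6 + 9 = 15 parameters suffice;    *)
(* this bounds the dimensions, as n + 1 polynomials in n variables are        *)
(* algebraically dependent, and the images of the coordinate flag of the      *)
(* parameter space are chains of these lengths.                               *)

Set Implicit Arguments.
Unset Strict Implicit.
Unset Printing Implicit Defensive.

Import Order.TTheory GRing.Theory Num.Theory.
Local Open Scope ring_scope.
Local Open Scope classical_set_scope.

(** The nilpotent CD-algebras turn out to be the union of the closures of [family112] and
    [family12]. Both closures are irreducible and neither contains the other, so
    [irreducible_components_setU2] identifies them as the components.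

    The variety lies in the union ([nilpotent_CD_sub]): [nilpotent_triangular] makes a structure
    strictly triangular, [CD_tabT_normal] moves it into the tables [tabL] or [tabF], and by
    [mem112_tabL] and [mem12_tabF] generic tables of these shapes belong to a family while the
    others are limits of such tables. Conversely, the CD identities and the vanishing of all words
    of four multiplications are polynomial conditions on the structure constants, hence survive in
    the closures.

    Both closures are also closures of images of polynomial maps from affine spaces of dimensions 18
    and 15 ([closure112E], [closure12E]). This yields irreducibility ([irreducible_closure_image]),
    the upper bound on the length of chains ([irreducible_chain_le]) and explicit chains attaining
    it ([irreducible_chain_image]). Since 18 > 15, the first closure is not inside the second; the
    second is not inside the first because it contains algebras whose products span three
    dimensions. *)

(** * Polynomial functions and Zariski closure *)

Section PolynomialFunctions.
Variable K : fieldType.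

(* The functions on T that are polynomials in a family X of coordinates.      *)
Inductive polyfun (T J : Type) (X : J -> T -> K) : (T -> K) -> Prop :=
| polyfun_gen j : polyfun X (X j)
| polyfun_cst c : polyfun X (fun=> c)
| polyfunD f g : polyfun X f -> polyfun X g -> polyfun X (fun x => f x + g x)
| polyfunM f g : polyfun X f -> polyfun X g -> polyfun X (fun x => f x * g x).

Definition coords (I : finType) (i : I) (x : affine K I) : K := x i.
Definition linecoord (_ : unit) (t : K) : K := t.

Section Closure.
Variables (T J : Type) (X : J -> T -> K).
Implicit Types f g : T -> K.

Lemma polyfun_ext f g : f =1 g -> polyfun X f -> polyfun X g.
Proof. by move=> /funext ->. Qed.

Lemma polyfunN f : polyfun X f -> polyfun X (fun x => - f x).
Proof.
move=> Xf; apply: (@polyfun_ext (fun x => -1 * f x)).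
  by move=> x; rewrite mulN1r.
by apply: polyfunM => //; apply: polyfun_cst.
Qed.

Lemma polyfunB f g : polyfun X f -> polyfun X g -> polyfun X (fun x => f x - g x).
Proof. by move=> Xf Xg; apply: polyfunD => //; apply: polyfunN. Qed.

Lemma polyfunX f n : polyfun X f -> polyfun X (fun x => f x ^+ n).
Proof.
move=> Xf; elim: n => [|n IH]; first exact: (polyfun_cst _ 1).
by apply: (@polyfun_ext (fun x => f x * f x ^+ n)) => [x|];
  [rewrite exprS | apply: polyfunM].
Qed.

Lemma polyfun_sum (A : Type) (r : seq A) (P : pred A) (F : A -> T -> K) :
  (forall a, P a -> polyfun X (F a)) ->
  polyfun X (fun x => \sum_(a <- r | P a) F a x).
Proof.
move=> XF; elim: r => [|a r IH].
  by apply: polyfun_ext (polyfun_cst _ 0) => x; rewrite big_nil.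
have [Pa|nPa] := boolP (P a).
  apply: polyfun_ext (polyfunD (XF a Pa) IH) => x.
  by rewrite big_cons Pa.
by apply: polyfun_ext IH => x; rewrite big_cons (negPf nPa).
Qed.

Lemma polyfun_prod (A : Type) (r : seq A) (P : pred A) (F : A -> T -> K) :
  (forall a, P a -> polyfun X (F a)) ->
  polyfun X (fun x => \prod_(a <- r | P a) F a x).
Proof.
move=> XF; elim: r => [|a r IH].
  by apply: polyfun_ext (polyfun_cst _ 1) => x; rewrite big_nil.
have [Pa|nPa] := boolP (P a).
  apply: polyfun_ext (polyfunM (XF a Pa) IH) => x.
  by rewrite big_cons Pa.
by apply: polyfun_ext IH => x; rewrite big_cons (negPf nPa).
Qed.

Lemma polyfun_det n (A : T -> 'M[K]_n) :
  (forall i j, polyfun X (fun x => A x i j)) -> polyfun X (fun x => \det (A x)).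
Proof.
move=> XA; apply: polyfun_sum => s _; apply: polyfunM; first exact: polyfun_cst.
by apply: polyfun_prod => i _.
Qed.

Lemma polyfun_adj n (A : T -> 'M[K]_n) :
  (forall i j, polyfun X (fun x => A x i j)) ->
  forall i j, polyfun X (fun x => (\adj (A x)) i j).
Proof.
move=> XA i j; apply: (@polyfun_ext (fun x => cofactor (A x) j i)) => [x|].
  by rewrite !mxE.
apply: polyfunM; first exact: polyfun_cst.
apply: polyfun_det => k l.
by apply: polyfun_ext (XA (lift j k) (lift i l)) => x; rewrite !mxE.
Qed.

Lemma polyfun_mulmx m n p (A : T -> 'M[K]_(m, n)) (B : T -> 'M[K]_(n, p)) :
  (forall i j, polyfun X (fun x => A x i j)) ->
  (forall i j, polyfun X (fun x => B x i j)) ->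
  forall i j, polyfun X (fun x => (A x *m B x) i j).
Proof.
move=> XA XB i j; apply: (@polyfun_ext (fun x => \sum_k A x i k * B x k j)).
  by move=> x; rewrite !mxE.
by apply: polyfun_sum => k _; apply: polyfunM.
Qed.

Lemma polyfun_comp (S L : Type) (Y : L -> S -> K) (phi : T -> S) h :
  (forall l, polyfun X (fun x => Y l (phi x))) -> polyfun Y h ->
  polyfun X (fun x => h (phi x)).
Proof.
move=> XY; elim=> //= [c|f g _ Xf _ Xg|f g _ Xf _ Xg].
- exact: polyfun_cst.
- exact: polyfunD.
- exact: polyfunM.
Qed.

End Closure.

Lemma polyfun_evalp (I : finType) (p : {mpoly K[#|I|]}) :
  polyfun (@coords I) (evalp p).
Proof.
rewrite /evalp; under eq_fun do rewrite mevalE.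
apply: polyfun_sum => m _; apply: polyfunM; first exact: polyfun_cst.
by apply: polyfun_prod => i _; apply: polyfunX; apply: (polyfun_gen (@coords I)).
Qed.

Lemma evalp_polyfun (I : finType) (f : affine K I -> K) :
  polyfun (@coords I) f -> exists p, f = evalp p.
Proof.
elim=> [i|c|g h _ [p ->] _ [q ->]|g h _ [p ->] _ [q ->]].
- exists 'X_(enum_rank i); apply/funext => x.
  by rewrite /evalp mevalXU enum_rankK.
- by exists c%:MP; apply/funext => x; rewrite /evalp mevalC.
- by exists (p + q); apply/funext => x; rewrite /evalp mevalD.
- by exists (p * q); apply/funext => x; rewrite /evalp mevalM.
Qed.

Lemma horner_polyfun (f : K -> K) :
  polyfun linecoord f -> exists p : {poly K}, forall t, f t = p.[t].
Proof.
elim=> [i|c|g h _ [p Ep] _ [q Eq]|g h _ [p Ep] _ [q Eq]].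
- by exists 'X => t; rewrite hornerX.
- by exists c%:P => t; rewrite hornerC.
- by exists (p + q) => t; rewrite Ep Eq hornerD.
- by exists (p * q) => t; rewrite Ep Eq hornerM.
Qed.

Definition polymap (T J : Type) (X : J -> T -> K) (I : finType)
    (phi : T -> affine K I) :=
  forall i, polyfun X (fun x => phi x i).

End PolynomialFunctions.

Section ZariskiClosure.
Variables (K : fieldType) (I : finType).
Local Notation A := (affine K I).
Implicit Types (S Z : set A) (f : A -> K).
Local Notation regular := (polyfun (@coords K I)).

Lemma closed_zero f : regular f -> closed [set x | f x = 0].
Proof.
move=> /evalp_polyfun[p ->]; apply/zariski_closedP; exists [set p].
by apply/seteqP; split => [x /= px _ ->|x /= /(_ p erefl)].
Qed.

Lemma closureP S x :
  closure S x <-> forall f, regular f -> (forall y, S y -> f y = 0) -> f x = 0.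
Proof.
split=> [Sx f rf Sf|Sx].
  have : closure S `<=` [set y | f y = 0].
    by rewrite closureE => y; apply; split => //; apply: closed_zero.
  by apply.
rewrite closureE => F [/zariski_closedP[P ->] SP] p Pp.
by apply: Sx; [apply: polyfun_evalp | move=> y Sy; apply: SP].
Qed.

Lemma closure_sub_closed S Z : closed Z -> S `<=` Z -> closure S `<=` Z.
Proof. by move=> cZ SZ; rewrite closureE => x; apply; split. Qed.

Lemma closed_separation Z x : closed Z -> ~ Z x ->
  exists f, [/\ regular f, (forall y, Z y -> f y = 0) & f x <> 0].
Proof.
move=> cZ nZx; have /closureP : ~ closure Z x by rewrite -((closure_id Z).1 cZ).
move=> /existsNP[f /not_implyP[rf /not_implyP[Zf fx]]].
by exists f; split.
Qed.

End ZariskiClosure.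

(** In characteristic zero the integers 0, 1, 2, ... are distinct, so there are more candidates than
    [p] can have roots. *)
Lemma numField_nonroot (K : numFieldType) (p : {poly K}) :
  p != 0 -> exists t, p.[t] != 0.
Proof.
move=> p0; apply: contrapT => /forallNP pK.
have := max_poly_roots p0 (rs := [seq n%:R | n <- iota 0 (size p)]).
rewrite size_map size_iota ltnn; move=> H.
suff : false by [].
apply: H.
  by apply/allP => t _; apply/negPn/negP => /pK.
rewrite map_inj_uniq ?iota_uniq //.
by move=> i j /eqP; rewrite eqr_nat => /eqP.
Qed.

Section Density.
Variables (K : numFieldType) (I : finType).
Local Notation A := (affine K I).
Implicit Types (S Z : set A).

Lemma line_common_nonzero (f g : K -> K) (s t : K) :
  polyfun (@linecoord K) f -> polyfun (@linecoord K) g ->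
  f s != 0 -> g t != 0 -> exists2 u, f u != 0 & g u != 0.
Proof.
move=> /horner_polyfun[p fp] /horner_polyfun[q gq]; rewrite fp gq => ps qt.
have [|u] := @numField_nonroot K (p * q).
  rewrite mulf_neq0 //; first by apply: contraNneq ps => ->; rewrite horner0.
  by apply: contraNneq qt => ->; rewrite horner0.
by rewrite hornerM mulf_eq0 negb_or -fp -gq => /andP[]; exists u.
Qed.

(** The tool behind every degeneration below. If [f] vanishes on [S] but not at [phi t], then [f]
    along the curve and [g] are non-zero polynomials in one variable; at a common non-root the curve
    is in the closure although [f] is non-zero there. *)
Lemma closure_curve S (phi : K -> A) (g : K -> K) (s : K) :
  polymap (@linecoord K) phi -> polyfun (@linecoord K) g -> g s != 0 ->
  (forall t, g t != 0 -> closure S (phi t)) -> forall t, closure S (phi t).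
Proof.
move=> phiP gP gs Sphi t; apply/closureP => f fP Sf.
apply/eqP/negPn/negP => fphi.
have [|u fu /Sphi /closureP] :=
    @line_common_nonzero (fun t => f (phi t)) g t s _ gP fphi gs.
  exact: polyfun_comp fP.
by move=> /(_ f fP Sf) /eqP; rewrite (negPf fu).
Qed.

(** If the closure lay in neither [F] nor [G], some [f] vanishing on [F] and some [g] vanishing on
    [G] would be non-zero at the images of two points of [D], hence both non-zero at one point of
    the line joining them. The set [D] is arbitrary so that coordinate subspaces can be used for
    chains. *)
Lemma irreducible_closure_image (J : finType) (D : set (affine K J))
    (phi : affine K J -> A) :
  D !=set0 -> (forall x y t, D x -> D y -> D [ffun j => x j + t * (y j - x j)]) ->
  polymap (@coords K J) phi -> irreducible (closure (phi @` D)).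
Proof.
move=> [x0 Dx0] Dline phiP; split.
  by exists (phi x0); apply: subset_closure; exists x0.
move=> F G cF cG FG; apply: contrapT => /not_orP[nF nG].
have key Z : closed Z -> ~ closure (phi @` D) `<=` Z -> exists x f,
    [/\ D x, polyfun (@coords K I) f, forall y, Z y -> f y = 0 & f (phi x) != 0].
  move=> cZ nZ; have : ~ phi @` D `<=` Z by move=> /(closure_sub_closed cZ).
  move=> /existsNP[_ /not_implyP[[x Dx <-] Zx]].
  have [f [fP Zf fx]] := closed_separation cZ Zx.
  by exists x, f; split => //; apply/eqP.
have [x [f [Dx fP Ff fx]]] := key F cF nF.
have [y [g [Dy gP Gg gy]]] := key G cG nG.
pose line t : affine K J := [ffun j => x j + t * (y j - x j)].
have line0 : line 0 = x by apply/ffunP => j; rewrite ffunE mul0r addr0.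
have line1 : line 1 = y by apply/ffunP => j; rewrite ffunE mul1r addrC subrK.
have lineP : forall i, polyfun (@linecoord K) (fun t => phi (line t) i).
  move=> i; apply: (polyfun_comp (phi := line) _ (phiP i)) => j.
  rewrite /coords; under eq_fun do rewrite ffunE.
  apply: polyfunD; first exact: polyfun_cst.
  apply: polyfunM; last exact: polyfun_cst.
  exact: (polyfun_gen (@linecoord K) tt).
have cP h : polyfun (@coords K I) h ->
    polyfun (@linecoord K) (fun t => h (phi (line t))).
  by move=> hP; apply: polyfun_comp hP.
have [||u fu gu] := line_common_nonzero (s := 0) (t := 1) (cP f fP) (cP g gP).
- by rewrite line0.
- by rewrite line1.
have : closure (phi @` D) (phi (line u)).
  by apply: subset_closure; exists (line u) => //; apply: Dline.
move=> /FG[/Ff|/Gg] /eqP; [exact/negP | exact/negP].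
Qed.

End Density.

(** * Krull dimension of closures of images *)

Section AlgebraicDependence.
Variable K : fieldType.

Lemma card_bounded_multinom (n b : nat) : (#|{: 'X_{1..n < b}}| <= b ^ n)%N.
Proof.
have [->|b0] := posnP b.
  have -> : #|{: 'X_{1..n < 0}}| = 0%N by apply: eq_card0 => m; have := bmdeg m.
  by [].
have mb (m : 'X_{1..n < b}) i : (m i < b)%N.
  by apply: leq_ltn_trans (bmdeg m); rewrite mdegE (bigD1 i) //= leq_addr.
pose f (m : 'X_{1..n < b}) : {ffun 'I_n -> 'I_b} :=
  [ffun i => Ordinal (mb m i)].
rewrite -[X in (_ <= X ^ _)%N]card_ord -[X in (_ <= _ ^ X)%N]card_ord -card_ffun.
apply: (@leq_card _ _ f) => m m' /ffunP ff.
apply/val_inj/mnmP => i; have := ff i; rewrite !ffunE.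
by move=> /(congr1 val).
Qed.

Lemma msizeM_bound n (p q : {mpoly K[n]}) a b :
  (msize p <= a.+1 -> msize q <= b.+1 -> msize (p * q) <= (a + b).+1)%N.
Proof.
have [->|p0] := eqVneq p 0; first by rewrite mul0r msize0.
have [->|q0] := eqVneq q 0; first by rewrite mulr0 msize0.
move=> pa qb; rewrite msizeM //.
rewrite (mpolySpred _ p0) (mpolySpred _ q0) addSn addnS /= ltnS.
by apply: leq_add; rewrite -ltnS -mpolySpred.
Qed.

Lemma msizeX_bound n (p : {mpoly K[n]}) a k :
  (msize p <= a.+1 -> msize (p ^+ k) <= (k * a).+1)%N.
Proof.
move=> pa; elim: k => [|k IH]; first by rewrite expr0 -mpolyC1 msize1.
by rewrite exprS mulSn; apply: msizeM_bound.
Qed.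

Lemma msize_prod_bound n m (p : 'I_m -> {mpoly K[n]}) a :
  (forall i, msize (p i) <= a.+1)%N -> (msize (\prod_i p i) <= (m * a).+1)%N.
Proof.
elim: m p => [|m IH] p pa; first by rewrite big_ord0 -mpolyC1 msize1.
by rewrite big_ord_recl mulSn; apply: msizeM_bound => //; apply: IH.
Qed.

(* The d^m monomials of partial degrees < d in the P i lie in a space of      *)
(* dimension O(d^n).                                                          *)
Lemma mpoly_dependent (n m : nat) (P : 'I_m -> {mpoly K[n]}) : (n < m)%N ->
  exists d (c : {ffun 'I_m -> 'I_d} -> K),
    (exists a, c a != 0) /\ \sum_a c a *: \prod_i P i ^+ a i = 0.
Proof.
move=> ltnm; pose D := (\max_i msize (P i))%N.
have PD i : (msize (P i) <= D.+1)%N.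
  exact: leq_trans (leq_bigmax i) (leqnSn _).
(* The products have degree below [B <= (m * D + 1) * d], so they involve at most
   [(m * D + 1) ^ n * d ^ n] monomials. This [d] makes that less than [d ^ n.+1], which is at most
   the number [d ^ m] of products. *)
pose d := ((m * D).+1 ^ n).+1; exists d.
pose Q (a : {ffun 'I_m -> 'I_d}) := \prod_i P i ^+ a i.
pose B := (m * (d.-1 * D)).+1.
have QB a : (msize (Q a) <= B)%N.
  apply: msize_prod_bound => i; apply: leq_trans (msizeX_bound _ (PD i)) _.
  by rewrite ltnS leq_mul2r -ltnS prednK // ltn_ord orbT.
have lt_card : (#|{: 'X_{1..n < B}}| < #|{ffun 'I_m -> 'I_d}|)%N.
  apply: leq_ltn_trans (card_bounded_multinom _ _) _.
  rewrite card_ffun !card_ord; apply: (@leq_ltn_trans ((m * D).+1 ^ n * d ^ n)).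
    have BD : (B <= (m * D).+1 * d)%N.
      rewrite [X in (_ <= X)%N]mulSn /B -add1n leq_add //.
      by rewrite -mulnA leq_mul2l [(D * d)%N]mulnC leq_mul2r leq_pred !orbT.
    rewrite -expnMn; have [n0|n0] := posnP n; last by rewrite leq_exp2r.
    by rewrite [X in (_ ^ X <= _)%N]n0 [X in (_ <= _ ^ X)%N]n0.
  apply: (@leq_trans (d ^ n.+1)%N); last exact: leq_pexp2l.
  by rewrite expnS ltn_mul2r expn_gt0 /=.
pose A : 'M[K]_(#|{ffun 'I_m -> 'I_d}|, #|{: 'X_{1..n < B}}|) :=
  \matrix_(a < _, j < _) (Q (enum_val a))@_(bmnm (enum_val j)).
have /rowV0Pn[u /sub_kermxP uA u0] : kermx A != 0.
  rewrite -mxrank_eq0 mxrank_ker subn_eq0 -ltnNge.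
  exact: leq_ltn_trans (rank_leq_col A) lt_card.
exists (fun a => u 0 (enum_rank a)); split.
  have /rV0Pn[j uj] := u0; exists (enum_val j).
  by rewrite enum_valK.
apply/mpolyP => mon; rewrite mcoeff0 raddf_sum /=.
under eq_bigr do rewrite mcoeffZ.
have [lt_mB|le_Bm] := ltnP (mdeg mon) B; last first.
  apply: big1 => a _; rewrite memN_msupp_eq0 ?mulr0 //.
  by apply: msize_mdeg_ge; apply: leq_trans (QB a) le_Bm.
have /matrixP /(_ 0 (enum_rank (BMultinom lt_mB))) := uA.
rewrite !mxE => uA0; rewrite -[RHS]uA0 [RHS](reindex enum_rank) /=; last first.
  by apply: onW_bij; apply: enum_rank_bij.
by apply: eq_bigr => a _; rewrite mxE !enum_rankK.
Qed.

End AlgebraicDependence.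

Section Dimension.
Variables (K : numFieldType) (I : finType).
Local Notation A := (affine K I).
Local Notation regular := (polyfun (@coords K I)).

(* If f i vanishes on F i but not on F i.+1, the monomials in f 0, ..., f i.-1*)
(* are linearly independent on F i: divide a relation by the least power of   *)
(* f i and restrict it to F i.                                                *)
Lemma chain_independent (F : nat -> set A) (f : nat -> A -> K) m d
    (c : {ffun 'I_m -> 'I_d} -> K) :
  (forall i, (i <= m)%N -> irreducible (F i)) ->
  (forall i, (i < m)%N -> F i `<=` F i.+1) ->
  (forall i, regular (f i)) ->
  (forall i, (i < m)%N -> forall x, F i x -> f i x = 0) ->
  (forall i, (i < m)%N -> exists2 x, F i.+1 x & f i x != 0) ->
  (forall x, F m x -> \sum_a c a * \prod_(k < m) f k x ^+ a k = 0) ->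
  forall a, c a = 0.
Proof.
move=> Firr Fsub freg f0 f1.
pose E := {ffun 'I_m -> 'I_d}.
(* Each restriction keeps only part of the monomials, so the induction runs over an arbitrary list
   [S] whose exponents [e] are separated by the first [i] functions. *)
have main i (im : (i <= m)%N) (S : seq E) (e : E -> nat -> nat) : uniq S ->
    {in S &, forall a b : E, (forall k, (k < i)%N -> e a k = e b k) -> a = b} ->
    {in S, forall a, c a != 0} ->
    (forall x, F i x -> \sum_(a <- S) c a * \prod_(k < i) f k x ^+ e a k = 0) ->
    S = [::].
  elim: i im S => [|i IH] im S uS eS cS HS.
    have [[x Fx] _] := Firr 0%N im.
    case: S uS eS cS HS => [|a [|b S]] //= uS eS cS HS.
      have /eqP := HS x Fx; rewrite big_seq1 big_ord0 mulr1 (negPf (cS a _)) //.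
      by rewrite inE.
    have ab : a = b by apply: eS; rewrite ?inE ?eqxx ?orbT.
    by move: uS; rewrite ab inE eqxx.
  have [S0|[a0 a0S]] : S = [::] \/ exists a, a \in S.
    by case: (S) => [|a s]; [left | right; exists a; rewrite inE eqxx].
    exact: S0.
  exfalso; have exP : exists n, has (fun a => e a i == n) S.
    by exists (e a0 i); apply/hasP; exists a0.
  case: (ex_minnP exP) => n /hasP[b bS /eqP bn] nmin.
  have len a : a \in S -> (n <= e a i)%N.
    by move=> aS; apply: nmin; apply/hasP; exists a.
  pose H x := \sum_(a <- S) c a * (\prod_(k < i) f k x ^+ e a k * f i x ^+ (e a i - n)).
  have Hreg : regular H.
    apply: polyfun_sum => a _; apply: polyfunM; first exact: polyfun_cst.
    apply: polyfunM; last exact: polyfunX.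
    by apply: polyfun_prod => k _; apply: polyfunX.
  have HF x : F i.+1 x -> f i x = 0 \/ H x = 0.
    move=> Fx; have := HS x Fx; have -> : \sum_(a <- S) c a *
        \prod_(k < i.+1) f k x ^+ e a k = f i x ^+ n * H x.
      rewrite /H mulr_sumr big_seq [RHS]big_seq; apply: eq_bigr => a /len na.
      rewrite big_ord_recr /= -{1}(subnKC na) exprD.
      by rewrite [RHS]mulrCA; congr (_ * _); rewrite [RHS]mulrCA.
    move=> /eqP; rewrite mulf_eq0 expf_eq0 => /orP[/andP[_ /eqP]|/eqP]; by [left|right].
  (* The irreducible set [F i.+1] is covered by the zeros of [f i] and those of [H], and [f i] does
     not vanish identically on it. *)
  have {}HF x : F i.+1 x -> H x = 0.
    have [_ /(_ _ _ (closed_zero (freg i)) (closed_zero Hreg))] := Firr i.+1 im.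
    case=> [y /HF //||]; last by apply.
    have [y Fy /eqP fy] := f1 i im.
    by move=> /(_ y Fy).
  have : [seq a <- S | e a i == n] = [::].
    apply: IH; first exact: ltnW.
    - exact: filter_uniq.
    - move=> a a'; rewrite !mem_filter => /andP[/eqP an aS] /andP[/eqP a'n a'S] aa'.
      apply: eS => // k; rewrite ltnS leq_eqVlt => /orP[/eqP ->|/aa' //].
      by rewrite an a'n.
    - by move=> a; rewrite mem_filter => /andP[_ /cS].
    - move=> x Fx; have := HF x (Fsub i im x Fx); rewrite /H.
      rewrite (bigID (fun a => e a i == n)) /= [X in _ + X]big_seq_cond.
      rewrite [X in _ + X]big1 ?addr0 => [Hx0|a /andP[aS an]].
        rewrite -[RHS]Hx0 big_filter; apply: eq_bigr => a /eqP an.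
        by rewrite an subnn expr0 mulr1.
      rewrite f0 // expr0n subn_eq0.
      by rewrite [(_ <= n)%N]leq_eqVlt (negPf an) ltnNge len //= !mulr0.
  move=> /(congr1 (fun s => b \in s)).
  by rewrite mem_filter bn eqxx bS in_nil.
move=> Fm a; apply/eqP/negPn/negP => ca.
pose e (a : E) k := oapp (fun k : 'I_m => nat_of_ord (a k)) 0%N (insub k).
have ee b (k : 'I_m) : e b k = b k by rewrite /e valK.
have aS : a \in [seq b <- enum {: E} | c b != 0] by rewrite mem_filter ca mem_enum.
suff E0 : [seq b <- enum {: E} | c b != 0] = [::] by rewrite E0 in aS.
apply: (main m (leqnn m) _ e).
- exact: filter_uniq (enum_uniq _).
- move=> b b' _ _ bb'; apply/ffunP => k; apply: val_inj => /=.
  by rewrite -!ee; apply: bb'.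
- by move=> b; rewrite mem_filter => /andP[].
- move=> x Fx; rewrite big_filter big_enum_cond -[RHS](Fm x Fx) /=.
  rewrite [RHS](bigID (fun b => c b != 0)) /= [X in _ + X]big1 ?addr0.
    by apply: eq_bigr => b _; under eq_bigr do rewrite ee.
  by move=> b /negPn/eqP->; rewrite mul0r.
Qed.

(** At each step of a chain take a regular function vanishing on the smaller set but not on the
    larger. Pulled back along [phi], these are [m] polynomials in [n] variables; if [n < m] they are
    dependent, the relation extends to the closure, and [chain_independent] is contradicted. *)
Lemma irreducible_chain_le n (phi : affine K 'I_n -> A) (X : set A) m :
  polymap (@coords K _) phi -> X = closure (range phi) ->
  irreducible_chain X m -> (m <= n)%N.
Proof.
move=> phiP XE [F [Fcl Flt]]; rewrite leqNgt; apply/negP => ltnm.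
have clX : closed X by rewrite XE; apply: closed_closure.
have clF i : (i <= m)%N -> closed (F i).
  by move=> /Fcl[[G cG ->] _]; apply: closedI.
have FX i : (i <= m)%N -> F i `<=` X.
  by move=> /Fcl[[G cG ->] _]; apply: subIsetl.
have /choice[f fP] i : exists f : A -> K, regular f /\ ((i < m)%N ->
    (forall x, F i x -> f x = 0) /\ exists2 x, F i.+1 x & f x != 0).
  case: (ltnP i m) => [im|_]; last by exists (fun=> 0); split=> //; apply: polyfun_cst.
  have [_ /existsNP[x /not_implyP[Fx nFx]]] := Flt i im.
  have [g [greg Fg gx]] := closed_separation (clF i (ltnW im)) nFx.
  by exists g; split=> // _; split=> //; exists x => //; apply/eqP.
have /choice[P Pf] i : exists p : {mpoly K[#|'I_n|]},
    forall t, f i (phi t) = evalp p t.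
  have [p pE] := evalp_polyfun (polyfun_comp phiP (fP i).1).
  by exists p => t; rewrite -pE.
have [|d [c [[a ca] c0]]] := @mpoly_dependent K _ m (fun i : 'I_m => P i).
  by rewrite card_ord.
suff : c a = 0 by move/eqP; rewrite (negPf ca).
apply: (@chain_independent F f) => //.
- by move=> i /Fcl[].
- by move=> i /Flt[].
- by move=> i; have [] := fP i.
- by move=> i im; have [_ /(_ im)[]] := fP i.
- by move=> i im; have [_ /(_ im)[]] := fP i.
- move=> x /(FX _ (leqnn m)); rewrite XE => /closureP Xx.
  apply: (Xx (fun x => \sum_a c a * \prod_(k < m) f k x ^+ a k)).
    apply: polyfun_sum => b _; apply: polyfunM; first exact: polyfun_cst.
    by apply: polyfun_prod => k _; apply: (polyfunX (f := f k)); case: (fP k).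
  move=> _ [t _ <-]; have := congr1 (fun p => evalp p t) c0.
  rewrite /evalp meval0 raddf_sum => /= c0t; rewrite -[RHS]c0t; apply: eq_bigr => b _.
  rewrite mevalZ rmorph_prod; congr (_ * _); apply: eq_bigr => k _.
  by rewrite /= rmorphXn /= Pf.
Qed.

Definition trunc n (v : nat -> K) j : affine K 'I_n :=
  [ffun i : 'I_n => if (i < j)%N then v i else 0].

(** The members of the chain are the closures of the images of the subspaces where all coordinates
    of index at least [j] vanish; [f j] separates consecutive ones, as witnessed by the truncations
    of [v]. *)
Lemma irreducible_chain_image n (phi : affine K 'I_n -> A) (X : set A)
    (v : nat -> K) (f : nat -> A -> K) :
  polymap (@coords K _) phi -> X = closure (range phi) ->
  (forall j, (j < n)%N -> regular (f j)) ->
  (forall j (t : affine K 'I_n), (j < n)%N ->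
     (forall k : 'I_n, (j <= k)%N -> t k = 0) -> f j (phi t) = 0) ->
  (forall j, (j < n)%N -> f j (phi (trunc n v j.+1)) != 0) ->
  irreducible_chain X n.
Proof.
move=> phiP XE freg f0 fv.
pose D j := [set t : affine K 'I_n | forall k : 'I_n, (j <= k)%N -> t k = 0].
have Dv j : D j (trunc n v j) by move=> k jk; rewrite ffunE ltnNge jk.
exists (fun j => closure (phi @` D j)); split=> j jn.
  split.
    exists (closure (phi @` D j)); first exact: closed_closure.
    apply/esym/setIidr; rewrite XE; apply: closureS.
    by move=> _ [t _ <-]; exists t.
  apply: irreducible_closure_image => //; first by exists (trunc n v j).
  move=> x y t Dx Dy k jk; rewrite ffunE (Dx k jk) (Dy k jk).
  by rewrite subrr mulr0 addr0.
split.
  apply: closureS => _ [t Dt <-]; exists t => // k jk.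
  exact/Dt/ltnW.
move=> /(_ (phi (trunc n v j.+1))).
have : closure (phi @` D j.+1) (phi (trunc n v j.+1)).
  by apply: subset_closure; exists (trunc n v j.+1).
move=> vj /(_ vj) /closureP /(_ (f j) (freg j jn)) fj.
suff f00 : f j (phi (trunc n v j.+1)) = 0 by have := fv j jn; rewrite f00 eqxx.
by apply: fj => _ [t Dt <-]; apply: f0.
Qed.

End Dimension.

(** * CD-algebras, nilpotency and the action of GL *)

Section Action.
Variables (K : fieldType) (n : nat).
Implicit Types (mu nu : structures K n) (g h : 'M[K]_n) (x y z : 'cV[K]_n).

Lemma amulDl mu x y z : amul mu (x + y) z = amul mu x z + amul mu y z.
Proof. by have := amulr_is_linear mu z 1 x y; rewrite /= !scale1r. Qed.

Lemma amulDr mu x y z : amul mu z (x + y) = amul mu z x + amul mu z y.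
Proof. exact: linearD. Qed.

Lemma amul0x mu z : amul mu 0 z = 0.
Proof. by apply: (addIr (amul mu 0 z)); rewrite -amulDl !add0r. Qed.

Lemma amulZl mu a x z : amul mu (a *: x) z = a *: amul mu x z.
Proof.
by have := amulr_is_linear mu z a x 0; rewrite /= !addr0 amul0x addr0.
Qed.

Lemma structuresP mu nu :
  (forall i j, amul mu (delta_mx i 0) (delta_mx j 0) =
               amul nu (delta_mx i 0) (delta_mx j 0)) -> mu = nu.
Proof.
move=> E; apply/ffunP => -[[i j] k]; have /colP/(_ k) := E i j.
by rewrite !amul_delta !mxE.
Qed.

Lemma invmx_eq g h : g *m h = 1%:M -> invmx g = h.
Proof.
move=> gh; have [gU _] := mulmx1_unit gh.
by rewrite -[LHS]mulmx1 -gh mulKmx.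
Qed.

Lemma gl_actionK g h mu : g \in unitmx -> h \in unitmx ->
  gl_action g (gl_action h mu) = gl_action (g *m h) mu.
Proof.
move=> gU hU; apply: structuresP => i j.
rewrite !gl_actionE (@invmx_eq (g *m h) (invmx h *m invmx g)) ?mulmxA //.
by rewrite mulmxK // mulmxV.
Qed.

Lemma gl_action1 mu : gl_action 1%:M mu = mu.
Proof.
by apply: structuresP => i j; rewrite gl_actionE invmx1 !mul1mx.
Qed.

Lemma gl_actionVK g mu : g \in unitmx -> gl_action (invmx g) (gl_action g mu) = mu.
Proof.
by move=> gU; rewrite gl_actionK ?unitmx_inv // mulVmx // gl_action1.
Qed.

Lemma gl_actionP g mu nu : g \in unitmx ->
  (forall i j, amul mu (g *m delta_mx i 0) (g *m delta_mx j 0) =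
               g *m amul nu (delta_mx i 0) (delta_mx j 0)) -> mu = gl_action g nu.
Proof.
move=> gU E; rewrite -[LHS]gl_action1 -[1%:M](mulmxV gU).
rewrite -gl_actionK ?unitmx_inv //; congr gl_action.
apply: structuresP => i j.
by rewrite gl_actionE invmxK E mulKmx.
Qed.

Lemma gl_orbit_sym mu nu : gl_orbit mu nu -> gl_orbit nu mu.
Proof.
by move=> [g gU ->]; exists (invmx g); rewrite ?unitmx_inv // gl_actionVK.
Qed.

(* A multiple of the action of h^-1 whose entries are polynomials in h.       *)
Definition poly_action h mu : structures K n :=
  [ffun t => let: (i, j, k) := t in
     (\adj h *m amul mu (h *m delta_mx i 0) (h *m delta_mx j 0)) k 0].

Lemma poly_actionE h mu : h \in unitmx ->
  poly_action h mu = gl_action ((\det h)^-1 *: invmx h) mu.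
Proof.
move=> hU; have d0 : \det h != 0 by rewrite -unitfE -unitmxE.
apply/ffunP => -[[i j] k]; rewrite !ffunE.
rewrite (@invmx_eq ((\det h)^-1 *: invmx h) (\det h *: h)); last first.
  by rewrite -scalemxAl -scalemxAr mulVmx // scalerA mulVf // scale1r.
rewrite -!scalemxAl amulZl amulZr -!scalemxAr !scalerA.
by rewrite mulKf // scalemxAl /invmx hU scalerA divff // scale1r.
Qed.

End Action.

Section ActionPolynomials.
Variables (K : fieldType) (n : nat) (T J : Type) (X : J -> T -> K).

Lemma polyfun_amul (mu : T -> structures K n) (x y : T -> 'cV[K]_n) k :
  polymap X mu -> (forall i, polyfun X (fun t => x t i 0)) ->
  (forall i, polyfun X (fun t => y t i 0)) ->
  polyfun X (fun t => amul (mu t) (x t) (y t) k 0).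
Proof.
move=> muP xP yP.
apply: (@polyfun_ext _ _ _ _
  (fun t => \sum_i \sum_j x t i 0 * y t j 0 * mu t (i, j, k))) => [t|].
  by rewrite !mxE.
apply: polyfun_sum => i _; apply: polyfun_sum => j _.
by apply: polyfunM; [apply: polyfunM|apply: muP].
Qed.

Lemma polymap_structures (mu : T -> structures K n) :
  (forall i j k, polyfun X (fun t => mu t (i, j, k))) -> polymap X mu.
Proof. by move=> muP [[i j] k]. Qed.

Lemma polymap_action (g h : T -> 'M[K]_n) (mu : T -> structures K n) :
  (forall i j, polyfun X (fun t => g t i j)) ->
  (forall i j, polyfun X (fun t => h t i j)) -> polymap X mu ->
  polymap X (fun t => [ffun ijk => let: (i, j, k) := ijk in
     (g t *m amul (mu t) (h t *m delta_mx i 0) (h t *m delta_mx j 0)) k 0]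
     : structures K n).
Proof.
move=> gP hP muP; apply: polymap_structures => i j k.
under eq_fun do rewrite ffunE.
have hdP l i' : polyfun X (fun t => (h t *m delta_mx l 0 : 'cV_n) i' 0).
  by apply: polyfun_mulmx => // a b; apply: polyfun_cst.
apply: polyfun_mulmx => // i' j'; rewrite (ord1 j').
exact: polyfun_amul.
Qed.

Lemma polymap_poly_action (h : T -> 'M[K]_n) (mu : T -> structures K n) :
  (forall i j, polyfun X (fun t => h t i j)) -> polymap X mu ->
  polymap X (fun t => poly_action (h t) (mu t)).
Proof. by move=> hP muP; apply: polymap_action => //; apply: polyfun_adj. Qed.

Lemma polymap_gl_action (g : T -> 'M[K]_n) (mu : T -> structures K n) :
  (forall t, \det (g t) = 1) ->
  (forall i j, polyfun X (fun t => g t i j)) -> polymap X mu ->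
  polymap X (fun t => gl_action (g t) (mu t)).
Proof.
move=> g1 gP muP; have gV t : invmx (g t) = \adj (g t).
  by rewrite /invmx unitmxE g1 unitr1 invr1 scale1r.
rewrite /gl_action; under eq_fun do rewrite gV.
by apply: polymap_action => //; apply: polyfun_adj.
Qed.

End ActionPolynomials.

Lemma regular_amul (K : fieldType) (n : nat) (u v : structures K n -> 'cV[K]_n) :
  (forall i, polyfun (@coords K _) (fun nu => u nu i 0)) ->
  (forall i, polyfun (@coords K _) (fun nu => v nu i 0)) ->
  forall i, polyfun (@coords K _) (fun nu => amul nu (u nu) (v nu) i 0).
Proof.
move=> uP vP i; apply: polyfun_amul => // j.
exact: (polyfun_gen (@coords K _)).
Qed.

Section CDAlgebras.
Variables (K : fieldType) (n : nat).
Implicit Types (mu : structures K n) (g : 'M[K]_n) (a b x y z w : 'cV[K]_n).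

Definition bracket mu (s t : bool) x y z :=
  commutator (if s then rmul mu x else lmul mu x)
             (if t then rmul mu y else lmul mu y) z.

Lemma bracket_linear mu s t x y : linear (bracket mu s t x y).
Proof.
move=> c a b; rewrite /bracket /commutator.
case: s t => -[]; rewrite /rmul /lmul;
  rewrite !(amulDl, amulDr, amulZl, amulZr) scalerBr -!addrA; congr (_ + _);
  by rewrite opprD addrCA.
Qed.

Lemma CD_algebraP mu : CD_algebra mu <->
  forall s t x y a b, (s ==> t) -> bracket mu s t x y (amul mu a b) =
    amul mu (bracket mu s t x y a) b + amul mu a (bracket mu s t x y b).
Proof.
split=> [CDmu s t x y a b|CDmu x y].
  by have [[_ ll] [_ lr] [_ rr]] := CDmu x y; case: s t => -[] // _;
    [apply: rr | apply: lr | apply: ll].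
split; split.
- exact: (bracket_linear mu false false).
- by move=> a b; apply: (CDmu false false).
- exact: (bracket_linear mu false true).
- by move=> a b; apply: (CDmu false true).
- exact: (bracket_linear mu true true).
- by move=> a b; apply: (CDmu true true).
Qed.

Lemma bracket_gl_action g mu s t x y z : g \in unitmx ->
  bracket (gl_action g mu) s t (g *m x) (g *m y) (g *m z) =
  g *m bracket mu s t x y z.
Proof.
move=> gU; rewrite /bracket /commutator mulmxBr.
by case: s t => -[]; rewrite /rmul /lmul !gl_actionE !mulKmx.
Qed.

Lemma CD_algebra_gl_action g mu : g \in unitmx ->
  CD_algebra mu -> CD_algebra (gl_action g mu).
Proof.
move=> gU /CD_algebraP CDmu; apply/CD_algebraP => s t x y a b st.
rewrite -[x](mulKVmx gU) -[y](mulKVmx gU) -[a](mulKVmx gU) -[b](mulKVmx gU).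
rewrite [amul _ (g *m _) (g *m _)]gl_actionE !mulKmx // !bracket_gl_action //.
by rewrite CDmu // mulmxDr !gl_actionE !mulKmx.
Qed.

Lemma CD_algebra_closure (S : set (structures K n)) mu :
  (forall nu, S nu -> CD_algebra nu) -> closure S mu -> CD_algebra mu.
Proof.
move=> SCD /closureP Smu; apply/CD_algebraP => s t x y a b st.
apply/colP => k; apply/eqP; rewrite -subr_eq0; apply/eqP.
apply: (Smu (fun nu => bracket nu s t x y (amul nu a b) k 0 -
  (amul nu (bracket nu s t x y a) b + amul nu a (bracket nu s t x y b)) k 0)).
- have brP (u : structures K n -> 'cV[K]_n) : (forall i, polyfun (@coords K _) (fun nu => u nu i 0)) ->
      forall i, polyfun (@coords K _) (fun nu => bracket nu s t x y (u nu) i 0).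
    move=> uP i; rewrite /bracket /commutator.
    under eq_fun do rewrite 2!mxE.
    have lP (v : structures K n -> 'cV[K]_n) : (forall j, polyfun (@coords K _) (fun nu => v nu j 0)) ->
      forall z j, polyfun (@coords K _) (fun nu => amul nu z (v nu) j 0).
      by move=> vP z j; apply: regular_amul => // i'; apply: polyfun_cst.
    have rP (v : structures K n -> 'cV[K]_n) : (forall j, polyfun (@coords K _) (fun nu => v nu j 0)) ->
      forall z j, polyfun (@coords K _) (fun nu => amul nu (v nu) z j 0).
      by move=> vP z j; apply: regular_amul => // i'; apply: polyfun_cst.
    apply: polyfunB; case: (s); case: (t); rewrite /rmul /lmul /=;
      by [apply: rP (rP _ uP _) _ _|apply: lP (rP _ uP _) _ _|apply: rP (lP _ uP _) _ _|apply: lP (lP _ uP _) _ _].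
  have cP u i : polyfun (@coords K _) (fun _ : structures K n => (u : 'cV[K]_n) i 0).
    exact: polyfun_cst.
  apply: polyfunB.
    by apply: brP; apply: (@regular_amul K n (fun=> a) (fun=> b)) => i; apply: cP.
  under eq_fun do rewrite mxE.
  by apply: polyfunD; apply: regular_amul => i; (try exact: cP);
    [apply: (brP (fun=> a)) | apply: (brP (fun=> b))] => i'; apply: cP.
- move=> nu /SCD/CD_algebraP /(_ s t x y a b st) ->.
  by rewrite subrr.
Qed.

End CDAlgebras.

Section Nilpotency.
Variables (K : fieldType) (n : nat).
Implicit Types (mu : structures K n) (g : 'M[K]_n) (x y z : 'cV[K]_n).

(* All words of length m in left and right multiplications kill z: unlike the *)
(* vanishing of a power of the algebra, this is visibly a closed condition.   *)
Fixpoint annihilated mu m z : Prop :=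
  if m is m'.+1 then
    forall x, annihilated mu m' (amul mu x z) /\ annihilated mu m' (amul mu z x)
  else z = 0.

Lemma annihilated_gl_action g mu m z : g \in unitmx ->
  annihilated mu m z -> annihilated (gl_action g mu) m (g *m z).
Proof.
move=> gU; elim: m z => /= [z ->|m IH z Hz x]; first by rewrite mulmx0.
rewrite !gl_actionE mulKmx //.
by have [H1 H2] := Hz (invmx g *m x); split; apply: IH.
Qed.

Lemma annihilated_closure m (S : set (structures K n))
    (Z : structures K n -> 'cV[K]_n) mu :
  (forall i, polyfun (@coords K _) (fun nu => Z nu i 0)) ->
  (forall nu, S nu -> annihilated nu m (Z nu)) -> closure S mu ->
  annihilated mu m (Z mu).
Proof.
move=> ZP SZ Smu; elim: m Z ZP SZ => /= [|m IH] Z ZP SZ.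
  apply/colP => i; rewrite mxE; move/closureP: Smu => /(_ _ (ZP i)); apply.
  by move=> nu /SZ ->; rewrite mxE.
have cP u i : polyfun (@coords K _) (fun _ : structures K n => (u : 'cV[K]_n) i 0).
  exact: polyfun_cst.
move=> x; split.
  apply: (IH (fun nu => amul nu x (Z nu))); last by move=> nu /SZ /(_ x)[].
  by apply: (regular_amul (u := fun=> x)).
apply: (IH (fun nu => amul nu (Z nu) x)); last by move=> nu /SZ /(_ x)[].
by apply: (regular_amul (v := fun=> x)).
Qed.

Lemma annihilated_sum mu m (I : finType) (c : I -> K) (z : I -> 'cV[K]_n) :
  (forall i, annihilated mu m (z i)) -> annihilated mu m (\sum_i c i *: z i).
Proof.
elim: m z => /= [|m IH] z Hz.
  by apply: big1 => i _; rewrite Hz scaler0.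
move=> x; split; last first.
  by rewrite amul_suml; apply: IH => i; have [] := Hz i x.
rewrite linear_sum; under eq_bigr do rewrite /= amulZr.
by apply: IH => i; have [] := Hz i x.
Qed.

Lemma annihilated_span mu m (s : seq 'cV[K]_n) z :
  {in s, forall u, annihilated mu m u} -> z \in <<s>>%VS -> annihilated mu m z.
Proof.
move=> Hs; rewrite -[s]/(tval (in_tuple s)) => /coord_span ->.
by apply: annihilated_sum => i; apply: Hs; apply: mem_nth.
Qed.

Lemma annihilated_add mu m x y :
  annihilated mu m x -> annihilated mu m y -> annihilated mu m (x + y).
Proof.
elim: m x y => /= [x y -> ->|m IH x y Hx Hy z]; first by rewrite addr0.
have [[? ?] [? ?]] := (Hx z, Hy z).
by rewrite amulDl amulDr; split; apply: IH.
Qed.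

(** In a product belonging to a power of index at least [2 ^ k.+1], one factor belongs to a power of
    index at least [2 ^ k]. Hence each doubling of the index accounts for one more multiplication,
    and the power of index [2 ^ m] is zero. *)
Lemma annihilated_nilpotent mu m :
  (forall z, annihilated mu m z) -> nilpotent_algebra mu.
Proof.
move=> Hm.
have key k : (k <= m)%N -> forall r, (2 ^ k <= r)%N ->
    forall z, z \in apower mu r -> annihilated mu (m - k) z.
  elim: k => [|k IH] km r kr z; first by rewrite subn0.
  rewrite apowerE; last by apply: leq_trans kr; rewrite expnS leq_pmulr // expn_gt0.
  have annS u : (annihilated mu (m - k) u) -> forall x,
      annihilated mu (m - k.+1) (amul mu x u) /\ annihilated mu (m - k.+1) (amul mu u x).
    by rewrite -(subnSK km) => Hu x; apply: Hu.
  rewrite big_nat_cond => zr.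
  suff: forall W : {vspace 'cV[K]_n}, W = (\sum_(1 <= i < r | (1 <= i < r)%N && true)
      aprodv mu (apower mu i) (apower mu (r - i)))%VS ->
      forall z, z \in W -> annihilated mu (m - k.+1) z by move=> /(_ _ erefl z zr).
  move=> W {z zr} ->; elim/big_ind: _ => [z|U V HU HV z|i].
  - rewrite memv0 => /eqP ->; have := annihilated_sum (I := 'I_0) (fun i => 0) (z := fun=> 0).
    by move=> /(_ mu (m - k.+1)%N); rewrite big_ord0; apply; case.
  - by move=> /memv_addP[u /HU Hu [v /HV Hv ->]]; apply: annihilated_add.
  - move=> /andP[/andP[i0 ir] _] z; apply: annihilated_span => _ /allpairsP[[u v] /= [uU vV ->]].
    have [ki|ik] := leqP (2 ^ k) i.
      by apply: (annS u _ v).2; apply: (IH (ltnW km) i) => //; apply: vbasis_mem.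
    apply: (annS v _ u).1; apply: (IH (ltnW km) (r - i)%N); last exact: vbasis_mem.
    rewrite leq_subRL; last exact: ltnW.
    by apply: leq_trans kr; rewrite expnS mul2n -addnn leq_add2r ltnW.
exists (2 ^ m)%N; rewrite expn_gt0; split=> //.
apply/eqP; rewrite -subv0; apply/subvP => z zm.
by have := key m (leqnn m) _ (leqnn _) z zm; rewrite subnn /= => ->; rewrite memv0.
Qed.

End Nilpotency.

(** * Triangular bases of nilpotent algebras *)

Section Triangularization.
Variables (K : fieldType) (n : nat).
Implicit Types (mu : structures K n) (x y z : 'cV[K]_n) (U W : {vspace 'cV[K]_n}).

Lemma aprodvS mu U U' W W' : (U <= U')%VS -> (W <= W')%VS ->
  (aprodv mu U W <= aprodv mu U' W')%VS.
Proof.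
move=> /subvP UU /subvP WW; apply/aprodv_subP => u w /UU uU /WW wW.
by have /aprodv_subP := subvv (aprodv mu U' W'); apply.
Qed.

Lemma nilpotent_proper mu U : nilpotent_algebra mu ->
  (U <= aprodv mu fullv U + aprodv mu U fullv)%VS -> U = 0%VS.
Proof.
move=> [m [m0 Am]] HU; suff main k : (U <= apower mu k.+1)%VS.
  by apply/eqP; rewrite -subv0 -Am -(prednK m0).
elim: k => [|k IH]; first by rewrite apower1 subvf.
apply: subv_trans HU _; rewrite apowerE // subv_add; apply/andP; split.
  rewrite big_ltn // subSS subn0; apply: subv_trans (addvSl _ _).
  exact: aprodvS.
rewrite big_nat_recr //= subSnn; apply: subv_trans (addvSr _ _).
exact: aprodvS.
Qed.

Lemma exists_functional W z : z \notin W ->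
  exists phi : 'rV[K]_n, (forall w, w \in W -> phi *m w = 0) /\ phi *m z != 0.
Proof.
move=> zW; pose f := daddv_pi W^C W.
have dW : (W^C :&: W = 0)%VS by rewrite capvC capv_compl.
have dW' : (W :&: W^C = 0)%VS by rewrite capv_compl.
have WW w : w \in (W^C + W)%VS by rewrite addvC addv_complf memvf.
have fW w : w \in W -> f w = 0.
  move=> wW; have := daddv_pi_add dW (w := w); rewrite (daddv_pi_id dW' wW).
  by move=> /(_ (WW w))/(canRL (addrK _)); rewrite subrr.
have /colP/existsNP[i /eqP fzi] : f z <> 0.
  move=> fz0; have := daddv_pi_add dW (w := z); rewrite -/f fz0 add0r.
  by move=> /(_ (WW z)) zE; case/negP: zW; rewrite -zE memv_pi.
pose phi : 'rV[K]_n := \row_j f (delta_mx j 0) i 0.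
have phiE w : phi *m w = (f w i 0)%:M.
  rewrite [RHS]mx11_scalar mxE eqxx mulr1n [LHS]mx11_scalar !mxE.
  have -> : w = \sum_j w j 0 *: delta_mx j 0.
    rewrite {1}(matrix_sum_delta w); apply: eq_bigr => j _.
    by rewrite big_ord_recl big_ord0 addr0.
  rewrite linear_sum summxE; congr (_%:M); apply: eq_bigr => j _.
  rewrite linearZ !mxE mulrC; congr (_ * _).
  rewrite summxE (bigD1 j) //= big1 ?addr0 => [|k kj]; rewrite !mxE ?eqxx ?mulr1 //.
  by rewrite eq_sym (negPf kj) mulr0.
exists phi; split=> [w /fW fw|]; first by rewrite phiE fw mxE raddf0.
rewrite phiE; apply: contraNneq fzi => /matrixP /(_ 0 0).
by rewrite !mxE eqxx mulr1n => ->.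
Qed.

(** The rows of [A] are functionals. While their common kernel [Z] is non-zero, nilpotency prevents
    it from lying in the span of its products with the whole algebra, so some functional kills these
    products but not [Z]. It is put on top, so that each row is controlled by the rows below it. *)
Lemma nilpotent_flag mu k : nilpotent_algebra mu -> (k <= n)%N ->
  exists A : 'M[K]_(k, n), row_free A /\ forall (r : 'I_k) x y,
    (forall l : 'I_k, (r < l)%N -> (A *m x) l 0 = 0) ->
    (A *m amul mu x y) r 0 = 0 /\ (A *m amul mu y x) r 0 = 0.
Proof.
move=> nil; elim: k => [_|k IH kn].
  by exists 0; split; [rewrite /row_free mxrank0 | case].
have [A [Afree AP]] := IH (ltnW kn).
pose Z := lker (linfun (mulmx A : 'cV[K]_n -> 'cV[K]_k)).
have ZE x : (x \in Z) = (A *m x == 0) by rewrite memv_ker lfunE.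
have Zprod : ~~ (Z <= aprodv mu fullv Z + aprodv mu Z fullv)%VS.
  apply/negP => /(nilpotent_proper nil) Z0.
  have /rowV0Pn[u /sub_kermxP uA u0] : kermx A^T != 0.
    rewrite -mxrank_eq0 mxrank_ker mxrank_tr subn_eq0 -ltnNge.
    by rewrite (eqP Afree).
  have : u^T \in Z by rewrite ZE -(trmxK A) -trmx_mul uA trmx0.
  by rewrite Z0 memv0 trmx_eq0 (negPf u0).
have [z zZ zW] := subvPn Zprod.
have [phi [phiW phiz]] := exists_functional zW.
rewrite -[k.+1]/(1 + k)%N; exists (col_mx phi A); split.
  rewrite -kermx_eq0; apply/rowV0P => v /sub_kermxP.
  rewrite -[v]hsubmxK mul_row_col => vA.
  have v0 : lsubmx v = 0.
    have := congr1 (mulmx^~ z) vA; rewrite /= mulmxDl -!mulmxA mul0mx.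
    move: zZ; rewrite ZE => /eqP ->; rewrite mulmx0 addr0.
    rewrite (mx11_scalar (phi *m z)) (mx11_scalar (lsubmx v)) -scalar_mxM.
    move/matrixP/(_ 0 0)/eqP; rewrite !mxE eqxx mulr1n mulf_eq0.
    have /negPf-> : \sum_j phi 0 j * z j 0 != 0.
      apply: contraNneq phiz => pz; apply/eqP/matrixP => a b.
      by rewrite !mxE !ord1.
    by rewrite orbF => /eqP ->; rewrite raddf0.
  move: vA; rewrite v0 mul0mx add0r => vA.
  by rewrite (row_free_inj Afree (x1 := rsubmx v) (x2 := 0)) ?mul0mx // row_mx0.
move=> r x y; case: (split_ordP r) => r' -> {r} H; rewrite !mul_col_mx.
  have Ax : A *m x = 0.
    apply/colP => l; rewrite [RHS]mxE; have := H (rshift 1 l).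
    by rewrite mul_col_mx col_mxEd; apply; rewrite (ord1 r').
  have xZ : x \in Z by rewrite ZE Ax.
  rewrite !col_mxEu !phiW ?mxE //.
    by apply: subvP (addvSl _ _) _ _; have /aprodv_subP := subvv (aprodv mu fullv Z); apply; rewrite ?memvf.
  by apply: subvP (addvSr _ _) _ _; have /aprodv_subP := subvv (aprodv mu Z fullv); apply; rewrite ?memvf.
rewrite !col_mxEd; apply: AP => l rl.
by have := H (rshift 1 l); rewrite mul_col_mx col_mxEd; apply; rewrite /= ltn_add2l.
Qed.

Lemma nilpotent_triangular mu : nilpotent_algebra mu ->
  exists2 g : 'M[K]_n, g \in unitmx & forall i j k : 'I_n,
    (k <= i)%N || (k <= j)%N -> gl_action g mu (i, j, k) = 0.
Proof.
move=> nil; have [A [Afree AP]] := nilpotent_flag nil (leqnn n).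
(* The flag lists the newest functional first; a triangular basis needs the opposite order. *)
pose s : {perm 'I_n} := perm (@rev_ord_inj n).
have sE i : s i = rev_ord i by rewrite permE.
exists (row_perm s A).
  by rewrite row_permE unitmx_mul unitmx_perm -row_free_unit.
have gU : row_perm s A \in unitmx.
  by rewrite row_permE unitmx_mul unitmx_perm -row_free_unit.
set g := row_perm s A in gU *.
have gx (x : 'cV[K]_n) l : (A *m x) (s l) 0 = (g *m x) l 0.
  by rewrite !mxE; apply: eq_bigr => a _; rewrite !mxE.
have key (i k : 'I_n) y : (k <= i)%N ->
    (g *m amul mu (invmx g *m delta_mx i 0) y) k 0 = 0 /\
    (g *m amul mu y (invmx g *m delta_mx i 0)) k 0 = 0.
  move=> ki; rewrite -!gx; apply: AP => l kl.
  have -> : l = s (rev_ord l) by rewrite sE rev_ordK.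
  rewrite gx mulKVmx // mxE; case: eqP => // li.
  move: kl (congr1 val li); rewrite sE /= => kl lin.
  by have := ltn_ord l; lia.
move=> i j k; rewrite ffunE => /orP[/key|/key] H; last by case: (H (invmx g *m delta_mx i 0)).
by case: (H (invmx g *m delta_mx j 0)).
Qed.

End Triangularization.

(** * Four-dimensional tables *)

Section Dimension4.
Variable K : fieldType.
Local Notation V := 'cV[K]_4.

Definition o1 : 'I_4 := @Ordinal 4 0 isT.
Definition o2 : 'I_4 := @Ordinal 4 1 isT.
Definition o3 : 'I_4 := @Ordinal 4 2 isT.
Definition o4 : 'I_4 := @Ordinal 4 3 isT.

Lemma ord4P (P : 'I_4 -> Prop) : P o1 -> P o2 -> P o3 -> P o4 -> forall i, P i.
Proof.
move=> P1 P2 P3 P4 [[|[|[|[|i]]]] Hi] //.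
- by rewrite (_ : Ordinal Hi = o1) //; apply: val_inj.
- by rewrite (_ : Ordinal Hi = o2) //; apply: val_inj.
- by rewrite (_ : Ordinal Hi = o3) //; apply: val_inj.
- by rewrite (_ : Ordinal Hi = o4) //; apply: val_inj.
Qed.

Lemma sum4 (A : zmodType) (F : 'I_4 -> A) :
  \sum_i F i = F o1 + F o2 + F o3 + F o4.
Proof.
rewrite !big_ord_recl big_ord0 addr0 !addrA.
by congr (F _ + F _ + F _ + F _); apply: val_inj.
Qed.

Definition vec (a b c d : K) : V := \col_i nth 0 [:: a; b; c; d] i.

Lemma vecP (v : V) : v = vec (v o1 0) (v o2 0) (v o3 0) (v o4 0).
Proof. by apply/colP; apply: ord4P; rewrite mxE. Qed.

Lemma vecD a b c d a' b' c' d' :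
  vec a b c d + vec a' b' c' d' = vec (a + a') (b + b') (c + c') (d + d').
Proof. by apply/colP; apply: ord4P; rewrite !mxE. Qed.

Lemma vecN a b c d : - vec a b c d = vec (- a) (- b) (- c) (- d).
Proof. by apply/colP; apply: ord4P; rewrite !mxE. Qed.

Lemma vecZ k a b c d : k *: vec a b c d = vec (k * a) (k * b) (k * c) (k * d).
Proof. by apply/colP; apply: ord4P; rewrite !mxE. Qed.

Lemma vec0 : 0 = vec 0 0 0 0.
Proof. by apply/colP; apply: ord4P; rewrite !mxE. Qed.

Definition vecE := (vecD, vecN, vecZ).

Lemma vec_inj a b c d a' b' c' d' : vec a b c d = vec a' b' c' d' ->
  [/\ a = a', b = b', c = c' & d = d'].
Proof.
move=> /colP E; move: (E o1) (E o2) (E o3) (E o4).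
by rewrite !mxE.
Qed.

Definition mx4 (u v w z : V) : 'M[K]_4 :=
  \matrix_(i, j) nth 0 [:: u i 0; v i 0; w i 0; z i 0] j.

Lemma mx4_delta u v w z :
  [/\ mx4 u v w z *m delta_mx o1 0 = u, mx4 u v w z *m delta_mx o2 0 = v,
      mx4 u v w z *m delta_mx o3 0 = w & mx4 u v w z *m delta_mx o4 0 = z].
Proof.
by split; apply/colP => i; rewrite mxE sum4 !mxE /=; ring.
Qed.

Lemma mx4_vec u v w z a b c d :
  mx4 u v w z *m vec a b c d = a *: u + b *: v + c *: w + d *: z.
Proof. by apply/colP => i; rewrite mxE sum4 !mxE /=; ring. Qed.

Lemma delta_vec :
  [/\ delta_mx o1 0 = vec 1 0 0 0, delta_mx o2 0 = vec 0 1 0 0,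
      delta_mx o3 0 = vec 0 0 1 0 & delta_mx o4 0 = vec 0 0 0 1].
Proof. by split; apply/colP; apply: ord4P; rewrite !mxE. Qed.

Lemma mx4_unit u v w z u' v' w' z' :
  mx4 u v w z *m u' = vec 1 0 0 0 -> mx4 u v w z *m v' = vec 0 1 0 0 ->
  mx4 u v w z *m w' = vec 0 0 1 0 -> mx4 u v w z *m z' = vec 0 0 0 1 ->
  mx4 u v w z \in unitmx.
Proof.
have [<- <- <- <-] := delta_vec => E1 E2 E3 E4.
suff /mulmx1_unit[] : mx4 u v w z *m mx4 u' v' w' z' = 1%:M by [].
apply/matrixP => i j; move: j i.
have entryE j (A : 'M[K]_4) i : A i j = (A *m delta_mx j 0 : V) i 0.
  by rewrite -colE mxE.
have [F1 F2 F3 F4] := mx4_delta u' v' w' z'.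
by apply: ord4P => i; rewrite entryE -mulmxA ?(F1, F2, F3, F4) ?(E1, E2, E3, E4)
  !mxE andbT.
Qed.

(* The general strictly triangular table: e1 e1 = a2 e2 + a3 e3 + a4 e4,      *)
(* e1 e2 = b3 e3 + b4 e4, e2 e1 = c3 e3 + c4 e4, e2 e2 = d3 e3 + d4 e4, and   *)
(* p, q, r, s, t are the e4-coefficients of e1 e3, e3 e1, e2 e3, e3 e2, e3 e3.*)
Definition tabT (a2 a3 a4 b3 b4 c3 c4 d3 d4 p q r s t : K) : structures K 4 :=
  structure_of_table (fun i j k =>
    match i, j, k with
    | 1, 1, 2 => a2 | 1, 1, 3 => a3 | 1, 1, 4 => a4
    | 1, 2, 3 => b3 | 1, 2, 4 => b4 | 2, 1, 3 => c3 | 2, 1, 4 => c4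
    | 2, 2, 3 => d3 | 2, 2, 4 => d4
    | 1, 3, 4 => p | 3, 1, 4 => q | 2, 3, 4 => r | 3, 2, 4 => s | 3, 3, 4 => t
    | _, _, _ => 0%R
    end%N).

Lemma structures4P (mu nu : structures K 4) :
  (forall i j k, mu (i, j, k) = nu (i, j, k)) -> mu = nu.
Proof. by move=> E; apply/ffunP => -[[i j] k]. Qed.

Lemma tabT_triangular (mu : structures K 4) :
  (forall i j k : 'I_4, (k <= i)%N || (k <= j)%N -> mu (i, j, k) = 0) ->
  mu = tabT (mu (o1, o1, o2)) (mu (o1, o1, o3)) (mu (o1, o1, o4))
    (mu (o1, o2, o3)) (mu (o1, o2, o4)) (mu (o2, o1, o3)) (mu (o2, o1, o4))
    (mu (o2, o2, o3)) (mu (o2, o2, o4)) (mu (o1, o3, o4)) (mu (o3, o1, o4))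
    (mu (o2, o3, o4)) (mu (o3, o2, o4)) (mu (o3, o3, o4)).
Proof.
move=> mu0; apply: structures4P.
by apply: ord4P; apply: ord4P; apply: ord4P; rewrite [RHS]ffunE //= mu0.
Qed.

Section Table.
Variables a2 a3 a4 b3 b4 c3 c4 d3 d4 p q r s t : K.
Local Notation T := (tabT a2 a3 a4 b3 b4 c3 c4 d3 d4 p q r s t).

Lemma amul_tabT x1 x2 x3 x4 y1 y2 y3 y4 :
  amul T (vec x1 x2 x3 x4) (vec y1 y2 y3 y4) =
  vec 0 (a2 * x1 * y1)
    (a3 * x1 * y1 + b3 * x1 * y2 + c3 * x2 * y1 + d3 * x2 * y2)
    (a4 * x1 * y1 + b4 * x1 * y2 + c4 * x2 * y1 + d4 * x2 * y2 + p * x1 * y3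
     + q * x3 * y1 + r * x2 * y3 + s * x3 * y2 + t * x3 * y3).
Proof.
apply/colP; apply: ord4P; rewrite mxE sum4 !sum4 !ffunE !mxE /=; ring.
Qed.

(** Every explicit change of basis below goes through this criterion: the columns of the matrix are
    the new basis, and their products give the table. *)
Lemma tabT_basis (mu : structures K 4) u v w z : mx4 u v w z \in unitmx ->
  amul mu u u = a2 *: v + a3 *: w + a4 *: z ->
  amul mu u v = b3 *: w + b4 *: z -> amul mu v u = c3 *: w + c4 *: z ->
  amul mu v v = d3 *: w + d4 *: z ->
  amul mu u w = p *: z -> amul mu w u = q *: z -> amul mu v w = r *: z ->
  amul mu w v = s *: z -> amul mu w w = t *: z ->
  (forall x, amul mu z x = 0 /\ amul mu x z = 0) ->
  mu = gl_action (mx4 u v w z) T.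
Proof.
move=> U uu uv vu vv uw wu vw wv ww z0; apply: gl_actionP => //.
have [E1 E2 E3 E4] := mx4_delta u v w z.
have [D1 D2 D3 D4] := delta_vec.
apply: ord4P; apply: ord4P; rewrite ?(E1, E2, E3, E4) ?(z0 _).1 ?(z0 _).2
  ?(D1, D2, D3, D4) amul_tabT mx4_vec ?(uu, uv, vu, vv, uw, wu, vw, wv, ww);
  by rewrite !(mulr0, mul0r, mulr1, addr0, add0r, scale0r).
Qed.

End Table.

Lemma polymap_tabT (T J : Type) (X : J -> T -> K)
    (a2 a3 a4 b3 b4 c3 c4 d3 d4 p q r s t : T -> K) :
  polyfun X a2 -> polyfun X a3 -> polyfun X a4 -> polyfun X b3 ->
  polyfun X b4 -> polyfun X c3 -> polyfun X c4 -> polyfun X d3 ->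
  polyfun X d4 -> polyfun X p -> polyfun X q -> polyfun X r ->
  polyfun X s -> polyfun X t ->
  polymap X (fun x => tabT (a2 x) (a3 x) (a4 x) (b3 x) (b4 x) (c3 x) (c4 x)
    (d3 x) (d4 x) (p x) (q x) (r x) (s x) (t x)).
Proof.
move=> *; apply: polymap_structures; apply: ord4P; apply: ord4P; apply: ord4P;
  under eq_fun do rewrite ffunE /=; by [exact: polyfun_cst |].
Qed.

End Dimension4.

Ltac solve_vec := rewrite !(amul_tabT, vecE) ?vec0; congr vec;
  field; by repeat (apply/andP; split).

Ltac solve_basis := apply: tabT_basis;
  [done | solve_vec | solve_vec | solve_vec | solve_vec | solve_vec | solve_vec
  | solve_vec | solve_vec | solve_vec
  | let x := fresh in
    intro x; rewrite (vecP x) !amul_tabT vec0; split; congr vec; ring].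

(** * Classification of strictly triangular CD-algebras *)

Section Classification.
Variable K : numFieldType.

(* The algebras with A A in <e3, e4>, A <e3, e4> + <e3, e4> A in <e4> and     *)
(* e4 annihilating A.                                                         *)
Definition tabL (a3 a4 b3 b4 c3 c4 d3 d4 p q r s t : K) :=
  tabT 0 a3 a4 b3 b4 c3 c4 d3 d4 p q r s t.

(* When e_i e_j lies in the span of the e_k with k >= i + j, the CD identity  *)
(* says that (p, q) is proportional to (2 b3 - c3, 2 c3 - b3).                *)
Definition tabF (a2 a3 a4 b3 b4 c3 c4 d4 m : K) :=
  tabT a2 a3 a4 b3 b4 c3 c4 0 d4 (m * (2 * b3 - c3)) (m * (2 * c3 - b3)) 0 0 0.

Section Equations.
Variables a2 a3 a4 b3 b4 c3 c4 d3 d4 p q r s t : K.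
Local Notation T := (tabT a2 a3 a4 b3 b4 c3 c4 d3 d4 p q r s t).
Hypothesis CDT : CD_algebra T.
Local Notation e1 := (vec 1 0 0 0 : 'cV[K]_4).
Local Notation e2 := (vec 0 1 0 0 : 'cV[K]_4).
Local Notation e3 := (vec 0 0 1 0 : 'cV[K]_4).

Local Tactic Notation "cd_equation" constr(s) constr(t) constr(x) constr(y) constr(a) constr(b) :=
  have := (CD_algebraP _).1 CDT s t x y a b isT;
  rewrite /bracket /commutator /= /rmul /lmul !(amul_tabT, vecE);
  move=> /vec_inj[_ _ _ /eqP]; rewrite -subr_eq0;
  move=> /eqP /(fun E e => etrans e E); apply; ring.

Lemma CD_tabT_pq : a2 * (p * (2 * c3 - b3) - q * (2 * b3 - c3)) = 0.
Proof. by cd_equation false true e1 e1 e1 e1. Qed.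

Lemma CD_tabT_t : [/\ - (a2 * b3 * t) = 0, - (a2 * c3 * t) = 0 & - (a2 * d3 * t) = 0].
Proof.
split; [cd_equation false false e1 e3 e1 e1 | cd_equation true true e1 e3 e1 e1
  | cd_equation false false e2 e3 e1 e1].
Qed.

Lemma CD_tabT_rs : a2 * d3 * s = 0 /\ a2 * d3 * r = 0.
Proof.
by split; [cd_equation false false e1 e2 e1 e2 | cd_equation false false e1 e2 e2 e1].
Qed.

Lemma CD_tabT_pqrs :
  [/\ a2 * (d3 * p - b3 * r + d3 * (p + q)) = 0,
      a2 * (d3 * p - b3 * s + d3 * (p + q)) = 0,
      - (a2 * (d3 * q - c3 * r + d3 * (p + q))) = 0 &
      a2 * (d3 * q - c3 * s + d3 * (p + q)) = 0].
Proof.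
split; [cd_equation false false e1 e2 e1 e1 | cd_equation false true e1 e2 e1 e1
  | cd_equation false true e2 e1 e1 e1 | cd_equation true true e1 e2 e1 e1].
Qed.

End Equations.

Lemma mx4_unit_lower (u2 u3 u4 v3 v4 w4 a b c d : K) : a * b * c * d != 0 ->
  mx4 (vec a u2 u3 u4) (vec 0 b v3 v4) (vec 0 0 c w4) (vec 0 0 0 d) \in unitmx.
Proof.
rewrite !mulf_eq0 !negb_or => /andP[/andP[/andP[a0 b0] c0] d0].
apply: (mx4_unit
  (u' := vec a^-1 (- u2 / (a * b)) ((u2 * v3 / b - u3) / (a * c))
    ((- (u4 / a) + u2 * v4 / (a * b) - (u2 * v3 / b - u3) / (a * c) * w4) / d))
  (v' := vec 0 b^-1 (- v3 / (b * c)) ((- v4 / b + v3 * w4 / (b * c)) / d))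
  (w' := vec 0 0 c^-1 (- w4 / (c * d))) (z' := vec 0 0 0 d^-1));
  rewrite mx4_vec !(vecE); congr vec; by field; rewrite ?a0 ?b0 ?c0 ?d0.
Qed.

(** If a2 = 0 the table already has shape [tabL]. If a2 and d3 are non-zero, the equations force p,
    q, r, s, t to vanish. If d3 = 0 and (b3, c3) is non-zero, then r, s, t vanish and (p, q) has the
    proportionality required by [tabF]. The case b3 = c3 = d3 = 0 remains, and returns to [tabL]. *)
Lemma CD_tabT_normal (a2 a3 a4 b3 b4 c3 c4 d3 d4 p q r s t : K) :
  let T := tabT a2 a3 a4 b3 b4 c3 c4 d3 d4 p q r s t in CD_algebra T ->
  exists2 g : 'M[K]_4, g \in unitmx &
    (exists x1 x2 x3 x4 x5 x6 x7 x8 x9 x10 x11 x12 x13,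
       T = gl_action g (tabL x1 x2 x3 x4 x5 x6 x7 x8 x9 x10 x11 x12 x13)) \/
    (exists x1 x2 x3 x4 x5 x6 x7 x8 x9,
       T = gl_action g (tabF x1 x2 x3 x4 x5 x6 x7 x8 x9)).
Proof.
move=> T CDT; rewrite /T in CDT *.
have three : (3 : K) != 0 by rewrite pnatr_eq0.
have [a20|a20] := eqVneq a2 0.
  exists 1%:M; first exact: unitmx1.
  by left; exists a3, a4, b3, b4, c3, c4, d3, d4, p, q, r, s, t; rewrite gl_action1 a20.
have /eqP := CD_tabT_pq CDT; rewrite mulf_eq0 (negPf a20) /= subr_eq0 => /eqP pq.
have [/eqP bt /eqP ct /eqP dt] := CD_tabT_t CDT.
have [/eqP ds /eqP dr] := CD_tabT_rs CDT.
have [/eqP h1 /eqP h2 /eqP h3 /eqP h4] := CD_tabT_pqrs CDT.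
move: bt ct dt ds dr h1 h2 h3 h4.
rewrite !oppr_eq0 -!mulrA !(mulf_eq0 a2) (negPf a20) /=.
have [d30|d30] := eqVneq d3 0; last first.
  rewrite !(mulf_eq0 d3) (negPf d30) /= => _ _ /eqP t0 /eqP s0 /eqP r0.
  rewrite r0 s0 t0 !mulr0 !subr0 => /eqP h1 _ /eqP h3 _.
  have p0 : p = 0.
    apply: (mulfI d30); apply: (mulfI three); rewrite mulr0 mulr0.
    transitivity (2 * (d3 * p + d3 * (p + q)) - (d3 * q + d3 * (p + q))); first by ring.
    by rewrite h1 h3 mulr0 subr0.
  have q0 : q = 0.
    apply: (mulfI d30); apply: (mulfI three); rewrite mulr0 mulr0.
    transitivity (2 * (d3 * q + d3 * (p + q)) - (d3 * p + d3 * (p + q))); first by ring.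
    by rewrite h1 h3 mulr0 subr0.
  rewrite p0 q0.
  (* With e2 e2 as the last basis vector and e4 as the third, the table becomes [tabF] with m =
     0. *)
  have gU : mx4 (vec 1 0 0 0) (vec 0 1 0 0) (vec 0 0 0 1) (vec 0 0 d3 d4) \in unitmx.
    apply: (mx4_unit (u' := vec 1 0 0 0) (v' := vec 0 1 0 0)
      (w' := vec 0 0 (- d4 / d3) d3^-1) (z' := vec 0 0 1 0));
      rewrite mx4_vec; solve_vec.
  eexists; first exact: gU.
   right; exists a2, (a4 - a3 * d4 / d3), (a3 / d3), (b4 - b3 * d4 / d3), (b3 / d3).
  exists (c4 - c3 * d4 / d3), (c3 / d3), 1, 0.
  by rewrite /tabF; solve_basis.
rewrite d30 !mul0r !add0r !addr0 !oppr_eq0 eqxx /=.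
have fromF : [&& t == 0, r == 0 & s == 0] -> ~~ ((b3 == 0) && (c3 == 0)) ->
    exists2 g : 'M[K]_4, g \in unitmx &
    (exists x1 x2 x3 x4 x5 x6 x7 x8 x9 x10 x11 x12 x13,
       tabT a2 a3 a4 b3 b4 c3 c4 0 d4 p q r s t =
       gl_action g (tabL x1 x2 x3 x4 x5 x6 x7 x8 x9 x10 x11 x12 x13)) \/
    (exists x1 x2 x3 x4 x5 x6 x7 x8 x9,
       tabT a2 a3 a4 b3 b4 c3 c4 0 d4 p q r s t =
       gl_action g (tabF x1 x2 x3 x4 x5 x6 x7 x8 x9)).
  move=> /and3P[/eqP-> /eqP-> /eqP->] bc0.
  suff [m [pm qm]] : exists m, p = m * (2 * b3 - c3) /\ q = m * (2 * c3 - b3).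
    eexists; first exact: unitmx1.
    by right; exists a2, a3, a4, b3, b4, c3, c4, d4, m; rewrite gl_action1 pm qm.
  (* As 3 is invertible, 2 b3 - c3 and 2 c3 - b3 cannot both vanish; [m] is the quotient by
     whichever is non-zero. *)
  have [c2b|bc] := eqVneq (2 * b3 - c3) 0.
    have [b2c|cb] := eqVneq (2 * c3 - b3) 0.
      case/negP: bc0; apply/andP; split; apply/eqP; apply: (mulfI three); rewrite mulr0.
        by transitivity (2 * (2 * b3 - c3) + (2 * c3 - b3)); [ring | rewrite c2b b2c mulr0 addr0].
      by transitivity (2 * (2 * c3 - b3) + (2 * b3 - c3)); [ring | rewrite c2b b2c mulr0 addr0].
    exists (q / (2 * c3 - b3)); rewrite divfK // c2b mulr0; split=> //.
    by apply: (mulIf cb); rewrite pq c2b mulr0 mul0r.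
  exists (p / (2 * b3 - c3)); rewrite divfK //; split=> //.
  by apply: (mulIf bc); rewrite -pq mulrAC divfK.
rewrite !(mulf_eq0 b3) !(mulf_eq0 c3).
have [b30|b30] := eqVneq b3 0; have [c30|c30] := eqVneq c3 0; rewrite /= ?andbT.
  move=> _ _ _ _ _ _ _ _ _; rewrite b30 c30.
  (* All basis products except e1 e1 now lie in the line of e4, so e3 becomes the second basis
     vector and e1 e1 the third. *)
  have gU : mx4 (vec 1 0 0 0) (vec 0 0 1 0) (vec 0 a2 a3 a4) (vec 0 0 0 1) \in unitmx.
    apply: (mx4_unit (u' := vec 1 0 0 0) (v' := vec 0 (- a3 / a2) a2^-1 (- a4 / a2))
      (w' := vec 0 1 0 0) (z' := vec 0 0 0 1));
      rewrite mx4_vec; solve_vec.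
  eexists; first exact: gU.
   left; exists 1, 0, 0, p, 0, q, 0, t.
  exists (a2 * b4 + a3 * p), (a2 * c4 + a3 * q), (a2 * s + a3 * t), (a2 * r + a3 * t).
  exists (a2 ^+ 2 * d4 + a2 * a3 * (r + s) + a3 ^+ 2 * t).
  by rewrite /tabL; solve_basis.
- by move=> _ t0 _ _ _ _ _ r0 s0; apply: fromF; rewrite ?t0 ?r0 ?s0 ?(negPf c30) ?andbF.
- by move=> t0 _ _ _ _ r0 s0 _ _; apply: fromF; rewrite ?t0 ?r0 ?s0 ?(negPf b30).
- by move=> t0 _ _ _ _ r0 s0 _ _; apply: fromF; rewrite ?t0 ?r0 ?s0 ?(negPf b30).
Qed.

End Classification.

(** * Degenerations of the two families *)

Lemma closure_gl_action (K : fieldType) n (S : set (structures K n))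
    (g : 'M[K]_n) mu :
  (forall nu, S nu -> S (gl_action g nu)) -> closure S mu ->
  closure S (gl_action g mu).
Proof.
move=> Sg /closureP Smu; apply/closureP => f fP Sf.
have gP : polymap (@coords K _) (gl_action g).
  apply: (polymap_action (g := fun=> g) (h := fun=> invmx g) (mu := id)).
  - by move=> i j; apply: polyfun_cst.
  - by move=> i j; apply: polyfun_cst.
  - by move=> i; apply: (polyfun_gen (@coords K _)).
apply: (Smu (fun nu => f (gl_action g nu))); first exact: polyfun_comp fP.
by move=> nu /Sg /Sf.
Qed.

Lemma closure_punctured (K : numFieldType) (I : finType) (S : set (affine K I))
    (phi : K -> affine K I) (c : K) :
  polymap (@linecoord K) phi -> (forall t, t != c -> closure S (phi t)) ->
  forall t, closure S (phi t).
Proof.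
move=> phiP Sphi; apply: (closure_curve (g := fun t => t - c) (s := c + 1)) => //.
- apply: polyfunB; last exact: polyfun_cst.
  exact: (polyfun_gen (@linecoord K) tt).
- by rewrite addrC addKr oner_eq0.
- by move=> t; rewrite subr_eq0; apply: Sphi.
Qed.

Section Components.
Variable K : numClosedFieldType.
Local Notation structures4 := (structures K 4).

Definition family112 : set structures4 :=
  [set mu | exists l a b g, gl_orbit (CD4_112 l a b g) mu].

Definition family12 : set structures4 :=
  [set mu | exists a l, gl_orbit (CD4_12 a l) mu].

Lemma gl_orbit_gl_action (mu nu : structures4) g : g \in unitmx ->
  gl_orbit mu nu -> gl_orbit mu (gl_action g nu).
Proof.
move=> gU [h hU ->]; exists (g *m h); first by rewrite unitmx_mul gU.
by rewrite gl_actionK.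
Qed.

Lemma closure112_action g mu : g \in unitmx ->
  closure family112 mu -> closure family112 (gl_action g mu).
Proof.
move=> gU; apply: closure_gl_action => nu [l [a [b [c H]]]].
by exists l, a, b, c; apply: gl_orbit_gl_action.
Qed.

Lemma closure12_action g mu : g \in unitmx ->
  closure family12 mu -> closure family12 (gl_action g mu).
Proof.
move=> gU; apply: closure_gl_action => nu [a [l H]].
by exists a, l; apply: gl_orbit_gl_action.
Qed.

Lemma CD4_112_tabL (l a b g : K) :
  CD4_112 l a b g = tabL l 1 0 0 1 b 1 0 a 0 g 0 1.
Proof.
by apply: structures4P; apply: ord4P; apply: ord4P; apply: ord4P; rewrite !ffunE.
Qed.

Lemma CD4_12_tabF (a l : K) : CD4_12 a l = tabF 1 0 0 1 0 l 0 a (-1).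
Proof.
by apply: structures4P; apply: ord4P; apply: ord4P; apply: ord4P; rewrite !ffunE //=; ring.
Qed.

Local Ltac solve_polymap := apply: polymap_tabT;
  repeat first [exact: polyfun_cst | exact: (polyfun_gen (@linecoord K) tt)
    | apply: polyfunB | apply: polyfunD | apply: polyfunM | apply: polyfunN].

Lemma mem112_scaled a3 a4 c3 c4 d3 p r t : a4 != 0 -> c3 != 0 -> d3 != 0 -> t != 0 ->
  closure family112 (tabL a3 a4 0 0 c3 c4 d3 0 p 0 r 0 t).
Proof.
(* Diagonal rescaling: normalizing e2 e2, e2 e1 and e3 e3 expresses all scales through that of e2,
   and the e4-coefficient of e1 e1 becomes 1 exactly when [a4 = y ^+ 2 * (c3 ^+ 2 * t)]. *)
move=> a40 c30 d30 t0; pose y := sqrtC (a4 / (c3 ^+ 2 * t)).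
have y0 : y != 0 by rewrite sqrtC_eq0 mulf_neq0 // invr_eq0 mulf_neq0 // expf_neq0.
have a4E : a4 = y ^+ 2 * (c3 ^+ 2 * t).
  by rewrite sqrtCK divfK // mulf_neq0 // expf_neq0.
clearbody y; rewrite a4E {a40 a4E a4}.
pose x := y * d3 / c3.
have gU : mx4 (vec x 0 0 0) (vec 0 y 0 0) (vec 0 0 (y ^+ 2 * d3) (0 : K))
    (vec 0 0 0 (y ^+ 4 * d3 ^+ 2 * t)) \in unitmx.
  by apply: mx4_unit_lower; rewrite /x !mulf_neq0 ?expf_neq0 ?invr_eq0.
apply: subset_closure; exists (d3 * a3 / c3 ^+ 2), (p / (y * c3 * t)),
  (c4 / (y ^+ 2 * c3 * d3 * t)), (r / (y * d3 * t)).
eexists; first exact: gU.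
rewrite CD4_112_tabL /tabL /x.
by solve_basis.
Qed.

Lemma mem112_diag (a3 a4 c3 c4 d3 p r t : K) :
  closure family112 (tabL a3 a4 0 0 c3 c4 d3 0 p 0 r 0 t).
Proof.
move: a4; apply: (closure_punctured (c := 0)); first by solve_polymap.
move=> a4 a40; move: c3; apply: (closure_punctured (c := 0)); first by solve_polymap.
move=> c3 c30; move: d3; apply: (closure_punctured (c := 0)); first by solve_polymap.
move=> d3 d30; move: t; apply: (closure_punctured (c := 0)); first by solve_polymap.
by move=> t t0; apply: mem112_scaled.
Qed.

(** When d3 is non-zero, replacing e1 by e1 - (b3 / d3) e2 makes e1 e2 vanish; no e4-term appears,
    because e2 is in the right kernel of the e4-valued form on e1, e2. *)
Lemma mem112_kernel (a3 a4 b3 c3 c4 d3 p r t : K) :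
  closure family112 (tabL a3 a4 b3 0 c3 c4 d3 0 p 0 r 0 t).
Proof.
move: d3; apply: (closure_punctured (c := 0)); first by solve_polymap.
move=> d3 d30; pose k := b3 / d3.
have gU : mx4 (vec 1 (- k) 0 0) (vec 0 1 0 0) (vec 0 0 1 0) (vec 0 0 0 1) \in unitmx.
  by apply: mx4_unit_lower; rewrite !mulr1 oner_eq0.
have -> : tabL a3 a4 b3 0 c3 c4 d3 0 p 0 r 0 t =
    gl_action (mx4 (vec 1 (- k) 0 0) (vec 0 1 0 0) (vec 0 0 1 0) (vec 0 0 0 1))
      (tabL (a3 - k * (b3 + c3) + k ^+ 2 * d3) (a4 - k * c4) 0 0 (c3 - k * d3) c4 d3 0
         (p - k * r) 0 r 0 t).
  by rewrite /tabL /k; solve_basis.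
by apply: closure112_action gU _; apply: mem112_diag.
Qed.

(** A singular form has a non-zero right kernel vector, here e1 or e2 - k e1; taking it as the
    second basis vector leads to [mem112_kernel]. *)
Lemma mem112_singular (a3 a4 b3 b4 c3 c4 d3 d4 p r t : K) : a4 * d4 = b4 * c4 ->
  closure family112 (tabL a3 a4 b3 b4 c3 c4 d3 d4 p 0 r 0 t).
Proof.
move=> det0.
have [[a40 c40]|[k [b4E d4E]]] : (a4 = 0 /\ c4 = 0) \/ exists k, b4 = k * a4 /\ d4 = k * c4.
- have [a40|a40] := eqVneq a4 0; last first.
    right; exists (b4 / a4); rewrite divfK //; split=> //.
    by apply: (mulfI a40); rewrite det0 [RHS]mulrCA mulrA divfK // mulrC mulrA.
  have [c40|c40] := eqVneq c4 0; [by left | right].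
  exists (d4 / c4); rewrite divfK // a40 mulr0; split=> //.
  by apply: (mulIf c40); rewrite -det0 a40 !mul0r.
- rewrite a40 c40.
  have gU : mx4 (vec 0 (1 : K) 0 0) (vec 1 0 0 0) (vec 0 0 1 0) (vec 0 0 0 1) \in unitmx.
    apply: (mx4_unit (u' := vec 0 1 0 0) (v' := vec 1 0 0 0)
      (w' := vec 0 0 1 0) (z' := vec 0 0 0 1)); rewrite mx4_vec; solve_vec.
  have -> : tabL a3 0 b3 b4 c3 0 d3 d4 p 0 r 0 t =
    gl_action (mx4 (vec 0 (1 : K) 0 0) (vec 1 0 0 0) (vec 0 0 1 0) (vec 0 0 0 1))
      (tabL d3 d4 c3 0 b3 b4 a3 0 r 0 p 0 t).
    by rewrite /tabL; solve_basis.
  by apply: closure112_action gU _; apply: mem112_kernel.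
have gU : mx4 (vec 1 0 0 0) (vec (- k) 1 0 0) (vec 0 0 1 0) (vec 0 0 0 1) \in unitmx.
  apply: (mx4_unit (u' := vec 1 0 0 0) (v' := vec k 1 0 0)
      (w' := vec 0 0 1 0) (z' := vec 0 0 0 1)); rewrite mx4_vec; solve_vec.
have -> : tabL a3 a4 b3 b4 c3 c4 d3 d4 p 0 r 0 t =
    gl_action (mx4 (vec 1 0 0 0) (vec (- k) 1 0 0) (vec 0 0 1 0) (vec 0 0 0 1))
      (tabL a3 a4 (b3 - k * a3) 0 (c3 - k * a3) (c4 - k * a4)
         (d3 - k * (b3 + c3) + k ^+ 2 * a3) 0 p 0 (r - k * p) 0 t).
  by rewrite b4E d4E /tabL; solve_basis.
by apply: closure112_action gU _; apply: mem112_kernel.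
Qed.

(* Over an algebraically closed field the pencil of bilinear forms            *)
(* (a4, b4, c4, d4) - w (a3, b3, c3, d3) has a singular member.               *)
Lemma mem112_pencil (a3 a4 b3 b4 c3 c4 d3 d4 p r t : K) :
  closure family112 (tabL a3 a4 b3 b4 c3 c4 d3 d4 p 0 r 0 t).
Proof.
move: a3; apply: (closure_punctured (c := 0)); first by solve_polymap.
move=> a3 a30; move: d3.
(* Away from this value the e3-valued form is nondegenerate, so the determinant of the pencil is a
   quadratic polynomial in [w] and has a root. *)
apply: (closure_punctured (c := b3 * c3 / a3)); first by solve_polymap.
move=> d3 d30; have D0 : a3 * d3 - b3 * c3 != 0.
  rewrite subr_eq0; apply: contraNneq d30 => <-.
  by rewrite mulrAC divff // mul1r.
have [w wE] : exists w, (a4 - w * a3) * (d4 - w * d3) = (b4 - w * b3) * (c4 - w * c3).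
  pose P : {poly K} := (a4%:P - 'X * a3%:P) * (d4%:P - 'X * d3%:P) -
    (b4%:P - 'X * b3%:P) * (c4%:P - 'X * c3%:P).
  have P2 : P`_2 = a3 * d3 - b3 * c3.
    have -> : P = (a3 * d3 - b3 * c3)%:P * 'X^2
      + (b4 * c3 + b3 * c4 - a4 * d3 - a3 * d4)%:P * 'X + (a4 * d4 - b4 * c4)%:P.
      by rewrite /P !(rmorphD, rmorphB, rmorphN, rmorphM) /=; ring.
    by rewrite !coefD !coefCM coefXn coefX coefC /= mulr1 mulr0 !addr0.
  have /closed_rootP[w /eqP] : size P != 1%N.
    by apply: contraNneq D0 => sP; rewrite -P2 nth_default // sP.
  rewrite /P !hornerE => p0; exists w; move: p0 => /eqP.
  by rewrite subr_eq0 => /eqP.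
(* Replacing e3 by e3 + w e4 subtracts [w] times the e3-valued form from the e4-valued one. *)
have gU : mx4 (vec 1 0 0 0) (vec 0 1 0 0) (vec 0 0 1 w) (vec 0 0 0 1) \in unitmx.
  by apply: mx4_unit_lower; rewrite !mulr1 oner_eq0.
have -> : tabL a3 a4 b3 b4 c3 c4 d3 d4 p 0 r 0 t =
    gl_action (mx4 (vec 1 0 0 0) (vec 0 1 0 0) (vec 0 0 1 w) (vec 0 0 0 1))
      (tabL a3 (a4 - w * a3) b3 (b4 - w * b3) c3 (c4 - w * c3) d3 (d4 - w * d3) p 0 r 0 t).
  by rewrite /tabL; solve_basis.
by apply: closure112_action gU _; apply: mem112_singular.
Qed.

(** When e3 e3 is non-zero, subtracting multiples of e3 from e1 and e2 kills e3 e1 and e3 e2. *)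
Lemma mem112_tabL (a3 a4 b3 b4 c3 c4 d3 d4 p q r s t : K) :
  closure family112 (tabL a3 a4 b3 b4 c3 c4 d3 d4 p q r s t).
Proof.
move: t; apply: (closure_punctured (c := 0)); first by solve_polymap.
move=> t t0.
have gU : mx4 (vec 1 0 (- q / t) 0) (vec 0 1 (- s / t) 0) (vec 0 0 1 0) (vec 0 0 0 1)
    \in unitmx.
  by apply: mx4_unit_lower; rewrite !mulr1 oner_eq0.
have -> : tabL a3 a4 b3 b4 c3 c4 d3 d4 p q r s t =
    gl_action (mx4 (vec 1 0 (- q / t) 0) (vec 0 1 (- s / t) 0) (vec 0 0 1 0) (vec 0 0 0 1))
      (tabL a3 (a4 - p * q / t) b3 (b4 - s * p / t) c3 (c4 - q * r / t) d3 (d4 - s * r / t)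
         (p - q) 0 (r - s) 0 t).
  by rewrite /tabL; solve_basis.
by apply: closure112_action gU _; apply: mem112_pencil.
Qed.

Lemma mem12_generic (a c4 l : K) : (1 - l) * (a + (1 + l) ^+ 2) != 0 ->
  closure family12 (tabF 1 0 0 1 0 l c4 a (-1)).
Proof.
rewrite mulf_eq0 negb_or => /andP[l1 al].
(* In [CD4_12 a l], the basis generated by e1 + y e2 has the same table except for a new
   e4-coefficient y (1 - l) (a + (1 + l)^2) of e2 e1; this [y] makes it c4. *)
pose y := c4 / ((1 - l) * (a + (1 + l) ^+ 2)).
have gU : mx4 (vec 1 y 0 0) (vec 0 1 (y * (1 + l)) (y ^+ 2 * a))
    (vec 0 0 1 (y * a + y * (1 + l) * (l - 2))) (vec 0 0 0 1) \in unitmx.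
  by apply: mx4_unit_lower; rewrite !mulr1 oner_eq0.
apply: subset_closure; exists a, l; apply: gl_orbit_sym; eexists; first exact: gU.
rewrite CD4_12_tabF /tabF /y.
by solve_basis.
Qed.

Lemma mem12_monic (a c4 l : K) : closure family12 (tabF 1 0 0 1 0 l c4 a (-1)).
Proof.
move: l; apply: (closure_punctured (c := 1)); first by solve_polymap.
move=> l l1; move: a; apply: (closure_punctured (c := - (1 + l) ^+ 2)).
  by solve_polymap.
move=> a al; apply: mem12_generic; rewrite mulf_neq0 // ?subr_eq0 1?eq_sym //.
by rewrite eq_sym addr_eq0.
Qed.

Lemma mem12_tabF (a2 a3 a4 b3 b4 c3 c4 d4 m : K) :
  closure family12 (tabF a2 a3 a4 b3 b4 c3 c4 d4 m).
Proof.
move: a2; apply: (closure_punctured (c := 0)); first by solve_polymap.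
move=> a2 a20; move: b3; apply: (closure_punctured (c := 0)); first by solve_polymap.
move=> b3 b30; move: m; apply: (closure_punctured (c := 0)); first by solve_polymap.
move=> m m0; pose p := m * (2 * b3 - c3); pose q := m * (2 * c3 - b3).
(* The new basis is e1, e1 e1, e1 (e1 e1) and the multiple of e4 that turns [m] into -1. *)
have gU : mx4 (vec 1 0 0 0) (vec 0 a2 a3 a4) (vec 0 0 (a2 * b3) (a2 * b4 + a3 * p))
    (vec 0 0 0 (- a2 * b3 ^+ 2 * m)) \in unitmx.
  by apply: mx4_unit_lower; rewrite mul1r !mulf_neq0 ?oppr_eq0 ?expf_neq0.
have -> : tabF a2 a3 a4 b3 b4 c3 c4 d4 m = gl_action
    (mx4 (vec 1 0 0 0) (vec 0 a2 a3 a4) (vec 0 0 (a2 * b3) (a2 * b4 + a3 * p))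
      (vec 0 0 0 (- a2 * b3 ^+ 2 * m)))
    (tabF 1 0 0 1 0 (c3 / b3)
       ((a2 * c4 + a3 * q - c3 / b3 * (a2 * b4 + a3 * p)) / (- a2 * b3 ^+ 2 * m))
       (- a2 * d4 / (b3 ^+ 2 * m)) (-1)).
  by rewrite /tabF; move: gU; rewrite /p /q => gU; solve_basis.
by apply: closure12_action gU _; apply: mem12_monic.
Qed.

Lemma nilpotent_CD_sub :
  nilpotent_CD K 4 `<=` closure family112 `|` closure family12.
Proof.
move=> mu [CDmu /nilpotent_triangular[g gU gmu]].
have := CD_algebra_gl_action gU CDmu; rewrite (tabT_triangular gmu).
set T := tabT _ _ _ _ _ _ _ _ _ _ _ _ _ _ => CDT.
have muE : mu = gl_action (invmx g) T.
  by rewrite /T -(tabT_triangular gmu) gl_actionVK.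
have gVU : invmx g \in unitmx by rewrite unitmx_inv.
have [h hU [] ] := CD_tabT_normal CDT.
  move=> [x1 [x2 [x3 [x4 [x5 [x6 [x7 [x8 [x9 [x10 [x11 [x12 [x13]]]]]]]]]]]]] TE.
  by left; rewrite muE; apply: closure112_action gVU _; rewrite /T TE;
    apply: closure112_action hU _; apply: mem112_tabL.
move=> [x1 [x2 [x3 [x4 [x5 [x6 [x7 [x8 [x9]]]]]]]]] TE.
by right; rewrite muE; apply: closure12_action gVU _; rewrite /T TE;
  apply: closure12_action hU _; apply: mem12_tabF.
Qed.

Lemma tabT_annihilated (a2 a3 a4 b3 b4 c3 c4 d3 d4 p q r s t : K) z :
  annihilated (tabT a2 a3 a4 b3 b4 c3 c4 d3 d4 p q r s t) 4 z.
Proof.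
rewrite (vecP z) => x; rewrite (vecP x) !amul_tabT.
split=> y; rewrite (vecP y) !amul_tabT !(mulr0, mul0r, addr0, add0r);
  split=> u; rewrite (vecP u) !amul_tabT !(mulr0, mul0r, addr0, add0r);
  split=> v; rewrite (vecP v) !amul_tabT !(mulr0, mul0r, addr0, add0r) vec0;
  by [].
Qed.

(** Both sides of each identity vanish: one multiplication lands in the span of e3 and e4, a second
    in that of e4, and a third gives zero. *)
Lemma tabL_CD (a3 a4 b3 b4 c3 c4 d3 d4 p q r s t : K) :
  CD_algebra (tabL a3 a4 b3 b4 c3 c4 d3 d4 p q r s t).
Proof.
apply/CD_algebraP => e f x y a b _; rewrite (vecP x) (vecP y) (vecP a) (vecP b).
rewrite /bracket /commutator /tabL.
by case: e f => -[]; rewrite /rmul /lmul !(amul_tabT, vecE); congr vec; ring.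
Qed.

(** With e_i of weight i, a product of four factors only sees their e1-parts and lies in the line of
    e4. There only the commutator of a left with a right multiplication matters; it gives the
    equation of [CD_tabT_pq], solved by this p and q. *)
Lemma tabF_CD (a2 a3 a4 b3 b4 c3 c4 d4 m : K) :
  CD_algebra (tabF a2 a3 a4 b3 b4 c3 c4 d4 m).
Proof.
apply/CD_algebraP => e f x y a b _; rewrite (vecP x) (vecP y) (vecP a) (vecP b).
rewrite /bracket /commutator /tabF.
by case: e f => -[]; rewrite /rmul /lmul !(amul_tabT, vecE); congr vec; ring.
Qed.

(** The uniform bound 4 is what lets nilpotency pass to the closure. *)
Lemma nilpotent_CD_closure (S : set structures4) :
  (forall mu, S mu -> CD_algebra mu /\ exists2 nu, gl_orbit nu mu &
     forall z, annihilated nu 4 z) ->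
  closure S `<=` nilpotent_CD K 4.
Proof.
move=> SP mu Smu; split.
  by apply: CD_algebra_closure Smu => nu /SP[].
apply: (annihilated_nilpotent (m := 4)) => z.
apply: (annihilated_closure (Z := fun=> z)) Smu => [i|nu /SP[_ [nu' [g gU ->] H]]].
  exact: polyfun_cst.
by rewrite -[z](mulKVmx gU); apply: annihilated_gl_action.
Qed.

Lemma closure112_nilpotent_CD : closure family112 `<=` nilpotent_CD K 4.
Proof.
apply: nilpotent_CD_closure => mu [l [a [b [c]]]]; rewrite CD4_112_tabL => mu_orb.
split; last by exists (tabL l 1 0 0 1 b 1 0 a 0 c 0 1) => // z; apply: tabT_annihilated.
by case: mu_orb => g gU ->; apply: CD_algebra_gl_action gU _; apply: tabL_CD.
Qed.

Lemma closure12_nilpotent_CD : closure family12 `<=` nilpotent_CD K 4.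
Proof.
apply: nilpotent_CD_closure => mu [a [l]]; rewrite CD4_12_tabF => mu_orb.
split; last by exists (tabF 1 0 0 1 0 l 0 a (-1)) => // z; apply: tabT_annihilated.
by case: mu_orb => g gU ->; apply: CD_algebra_gl_action gU _; apply: tabF_CD.
Qed.

End Components.

(** * Action of lower triangular matrices *)

Section LowerTriangular.
Variables (K : fieldType) (n : nat).
Implicit Types (mu : structures K n) (w : 'M[K]_n).

Lemma trig_unit_diag w i : is_trig_mx w -> w \in unitmx -> w i i != 0.
Proof.
move=> wT; rewrite unitmxE det_trig // unitfE => /prodf_neq0; exact.
Qed.

Lemma gl_action_inv_coef w mu i j k : w \in unitmx ->
  \sum_c w k c * gl_action (invmx w) mu (i, j, c) =
  \sum_a \sum_b w a i * w b j * mu (a, b, k).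
Proof.
move=> wU; set nu := gl_action _ _.
have : w *m amul nu (delta_mx i 0) (delta_mx j 0) =
    amul mu (w *m delta_mx i 0) (w *m delta_mx j 0).
  by rewrite gl_actionE invmxK mulKVmx.
rewrite amul_delta -!colE => /colP/(_ k); rewrite !mxE => E.
rewrite -[LHS](_ : \sum_c w k c * (\col_k nu (i, j, k)) c 0 = _); last first.
  by apply: eq_bigr => c _; rewrite mxE.
by rewrite E; apply: eq_bigr => a _; apply: eq_bigr => b _; rewrite !mxE.
Qed.

Variable D : 'I_n -> 'I_n -> 'I_n -> bool.

(** For triangular [w] the equations of [gl_action_inv_coef] form a triangular system in the
    coordinates of the new product, solved by induction on [k]. *)
Lemma gl_action_inv_support w mu : is_trig_mx w -> w \in unitmx ->
  (forall i j k a b c : 'I_n, (i <= a)%N -> (j <= b)%N -> (c <= k)%N ->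
     D a b c -> D i j k) ->
  (forall i j k, ~~ D i j k -> mu (i, j, k) = 0) ->
  forall i j k : 'I_n, ~~ D i j k -> gl_action (invmx w) mu (i, j, k) = 0.
Proof.
move=> wT wU Dmono muD i j k; have [m] := ubnP (val k).
elim: m k => // m IH k; rewrite ltnS => km nD.
have := gl_action_inv_coef mu i j k wU; rewrite [RHS]big1 => [|a _]; last first.
  apply: big1 => b _; have [ia|ai] := leqP i a; last first.
    by rewrite (is_trig_mxP wT a i ai) !mul0r.
  have [jb|bj] := leqP j b; last by rewrite (is_trig_mxP wT b j bj) mulr0 mul0r.
  by rewrite muD ?mulr0 //; apply: contra nD; apply: Dmono.
rewrite (bigD1 k) //= big1 ?addr0 => [/eqP|c ck].
  by rewrite mulf_eq0 (negPf (trig_unit_diag k wT wU)) => /eqP.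
have [lt_ck|] := ltnP c k.
  rewrite IH ?mulr0 //; first exact: leq_trans km.
  by apply: contra nD; apply: Dmono => //; apply: ltnW.
rewrite leq_eqVlt => /orP[/eqP kc|kc].
  by move: ck; rewrite -val_eqE /= kc eqxx.
by rewrite (is_trig_mxP wT k c kc) mul0r.
Qed.

Lemma gl_action_inv_extremal w mu (i j k : 'I_n) : is_trig_mx w -> w \in unitmx ->
  (forall a b : 'I_n, (i <= a)%N -> (j <= b)%N -> (a != i) || (b != j) ->
     mu (a, b, k) = 0) ->
  (forall c : 'I_n, (c < k)%N -> gl_action (invmx w) mu (i, j, c) = 0) ->
  w k k * gl_action (invmx w) mu (i, j, k) = w i i * w j j * mu (i, j, k).
Proof.
move=> wT wU mu0 nu0; have := gl_action_inv_coef mu i j k wU.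
rewrite (bigD1 k) //= big1 ?addr0 => [->|c ck]; last first.
  have [/nu0 ->|] := ltnP c k; first by rewrite mulr0.
  rewrite leq_eqVlt => /orP[/eqP kc|kc].
    by move: ck; rewrite -val_eqE /= kc eqxx.
  by rewrite (is_trig_mxP wT k c kc) mul0r.
have w0 a b : (a != i) || (b != j) -> w a i * w b j * mu (a, b, k) = 0.
  move=> ab; have [ia|ai] := leqP i a; last first.
    by rewrite (is_trig_mxP wT a i ai) !mul0r.
  have [jb|bj] := leqP j b; last by rewrite (is_trig_mxP wT b j bj) mulr0 mul0r.
  by rewrite mu0 // mulr0.
rewrite (bigD1 i) //= [X in _ + X]big1 ?addr0 => [|a ai]; last first.
  by apply: big1 => b _; rewrite w0 // ai.
by rewrite (bigD1 j) //= [X in _ + X]big1 ?addr0 // => b bj; rewrite w0 // bj orbT.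
Qed.

End LowerTriangular.

(** * Big cell *)

Section BigCell.
Variable K : numClosedFieldType.
Local Notation structures4 := (structures K 4).
Implicit Types (h : 'M[K]_4) (mu : structures4).

(* Its columns are the basis E_j = e_j + sum_(i < j) u_ij e_i. *)
Definition unipotent (u12 u13 u14 u23 u24 u34 : K) : 'M[K]_4 :=
  mx4 (vec 1 0 0 0) (vec u12 1 0 0) (vec u13 u23 1 0) (vec u14 u24 u34 1).

Lemma det_unipotent u12 u13 u14 u23 u24 u34 :
  \det (unipotent u12 u13 u14 u23 u24 u34) = 1.
Proof.
rewrite -det_tr det_trig; last first.
  apply/is_trig_mxP; apply: ord4P; apply: ord4P => // _; by rewrite !mxE.
rewrite big1 // => i _; move: i; apply: ord4P; by rewrite !mxE.
Qed.

Lemma unipotent_unit u12 u13 u14 u23 u24 u34 :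
  unipotent u12 u13 u14 u23 u24 u34 \in unitmx.
Proof. by rewrite unitmxE det_unipotent unitr1. Qed.

Definition minor1 h := h o1 o1.
Definition minor2 h := h o1 o1 * h o2 o2 - h o1 o2 * h o2 o1.
Definition minor3 h :=
  h o1 o1 * (h o2 o2 * h o3 o3 - h o2 o3 * h o3 o2)
  - h o1 o2 * (h o2 o1 * h o3 o3 - h o2 o3 * h o3 o1)
  + h o1 o3 * (h o2 o1 * h o3 o2 - h o2 o2 * h o3 o1).

Lemma lower_unipotent h : minor1 h != 0 -> minor2 h != 0 -> minor3 h != 0 ->
  exists u12 u13 u14 u23 u24 u34,
    is_trig_mx (h *m unipotent u12 u13 u14 u23 u24 u34).
Proof.
rewrite /minor1 /minor2 /minor3.
set h11 := h o1 o1; set h12 := h o1 o2; set h13 := h o1 o3.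
set h21 := h o2 o1; set h22 := h o2 o2; set h23 := h o2 o3.
set h31 := h o3 o1; set h32 := h o3 o2; set h33 := h o3 o3.
set h14 := h o1 o4; set h24 := h o2 o4; set h34 := h o3 o4.
move=> D1; set d2 := (X in X != 0) => D2; set d3 := (X in X != 0) => D3.
(* Cramer's rule: each column solves the linear system cancelling the entries above the diagonal,
   with a leading minor as denominator. *)
exists (- h12 / h11), ((h12 * h23 - h13 * h22) / d2).
exists (- (h14 * (h22 * h33 - h23 * h32) - h12 * (h24 * h33 - h23 * h34)
           + h13 * (h24 * h32 - h22 * h34)) / d3).
exists ((h13 * h21 - h11 * h23) / d2).
exists (- (h11 * (h24 * h33 - h23 * h34) - h14 * (h21 * h33 - h23 * h31)
           + h13 * (h21 * h34 - h24 * h31)) / d3).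
exists (- (h11 * (h22 * h34 - h24 * h32) - h12 * (h21 * h34 - h24 * h31)
           + h14 * (h21 * h32 - h22 * h31)) / d3).
apply/is_trig_mxP; apply: ord4P; apply: ord4P => // _; rewrite mxE sum4 !mxE /=;
  rewrite -/h11 -/h12 -/h13 -/h14 -/h21 -/h22 -/h23 -/h24 -/h31 -/h32 -/h33 -/h34.
all: rewrite ?/d2 ?/d3; field; by repeat (apply/andP; split).
Qed.

(** The curve [h] joins a multiple of the inverse of [g] to the identity. Wherever the leading
    minors are non-zero, [h t] has an LU decomposition and the hypothesis applies. Using
    [poly_action] keeps the curve polynomial. *)
Lemma closure_big_cell (X : set structures4) mu :
  (forall w u12 u13 u14 u23 u24 u34, is_trig_mx w -> w \in unitmx ->
     X (gl_action (unipotent u12 u13 u14 u23 u24 u34) (gl_action (invmx w) mu))) ->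
  forall g, g \in unitmx -> closure X (gl_action g mu).
Proof.
move=> HX g gU; pose d := \det (invmx g).
have d0 : d != 0 by rewrite -unitfE -unitmxE unitmx_inv.
(* [poly_action] inverts the matrix and divides by its determinant, so scaling by [x] contributes
   [x ^+ 5]: four factors from the determinant and one from the inverse. *)
pose x := 5.-root d^-1.
have x5 : x ^+ 5 = d^-1 by rewrite rootCK.
have x0 : x != 0 by rewrite /x rootC_eq0 // invr_eq0.
pose h (t : K) : 'M[K]_4 := x *: invmx g + t *: (1%:M - x *: invmx g).
have h1 : h 1 = 1%:M by rewrite /h scale1r addrC subrK.
have h0U : x *: invmx g \in unitmx.
  by rewrite unitmxE detZ unitfE mulf_neq0 // expf_neq0.
have -> : gl_action g mu = poly_action (h 0) mu.
  rewrite /h scale0r addr0 poly_actionE //; congr gl_action.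
  rewrite (@invmx_eq _ _ (x *: invmx g) (x^-1 *: g)); last first.
    by rewrite -scalemxAl -scalemxAr mulVmx // scalerA divff // scale1r.
  rewrite scalerA detZ -/d -invfM mulrAC -exprSr x5.
  by rewrite mulVf // invr1 scale1r.
have hP i j : polyfun (@linecoord K) (fun t => h t i j).
  apply: (@polyfun_ext _ _ _ _
    (fun t => (x *: invmx g) i j + t * (1%:M - x *: invmx g) i j)) => [t|].
    by rewrite /h [RHS]mxE [X in _ = _ + X]mxE.
  apply: polyfunD; first exact: polyfun_cst.
  apply: polyfunM; last exact: polyfun_cst.
  exact: (polyfun_gen (@linecoord K) tt).
suff : forall t, closure X (poly_action (h t) mu) by apply.
apply: (closure_curve
  (g := fun t => \det (h t) * minor1 (h t) * minor2 (h t)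
  * minor3 (h t)) (s := 1)).
- apply: (polymap_poly_action (mu := fun=> mu)) => // i; exact: polyfun_cst.
- rewrite /minor1 /minor2 /minor3.
  apply: polyfunM; last by repeat first [exact: hP | apply: polyfunB
    | apply: polyfunD | apply: polyfunM].
  apply: polyfunM; last by repeat first [exact: hP | apply: polyfunB
    | apply: polyfunD | apply: polyfunM].
  by apply: polyfunM; [exact: polyfun_det | exact: hP].
- rewrite h1 /minor1 /minor2 /minor3 det1 !mxE /=.
  by rewrite !(mulr1, mulr0, mul0r, subr0, addr0) oner_eq0.
move=> t; rewrite !mulf_eq0 !negb_or => /andP[/andP[/andP[dh m1] m2] m3].
have hU : h t \in unitmx by rewrite unitmxE unitfE.
have [u12 [u13 [u14 [u23 [u24 [u34]]]]]] := lower_unipotent m1 m2 m3.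
set U := unipotent _ _ _ _ _ _ => trigU.
have UU : U \in unitmx by apply: unipotent_unit.
pose w := \det (h t) *: (h t *m U).
have wU : w \in unitmx.
  by rewrite /w unitmxE detZ unitfE mulf_neq0 ?expf_neq0 // -unitfE -unitmxE unitmx_mul hU.
apply: subset_closure; rewrite poly_actionE //.
have -> : (\det (h t))^-1 *: invmx (h t) = U *m invmx w.
  rewrite (@invmx_eq _ _ w ((\det (h t))^-1 *: (invmx U *m invmx (h t)))).
    by rewrite -scalemxAr mulmxA mulmxV // mul1mx.
  rewrite /w -scalemxAl -scalemxAr scalerA divff // scale1r.
  by rewrite mulmxA mulmxK // mulmxV.
rewrite -gl_actionK ?unitmx_inv //; apply: HX => //.
apply/is_trig_mxP => i j ij; rewrite /w mxE.
by rewrite (is_trig_mxP trigU) // mulr0.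
Qed.

End BigCell.

(** * Parametrizations of the two closures *)

Section Parametrizations.
Variable K : numClosedFieldType.
Local Notation structures4 := (structures K 4).
Local Notation family112 := (@family112 K).
Local Notation family12 := (@family12 K).

(* The coordinate of index k, or 0 if k >= n. *)
Definition ncoord n (t : affine K 'I_n) (k : nat) : K := oapp t 0 (insub k).
Arguments ncoord : simpl never.

Lemma ncoord_ord n (t : affine K 'I_n) (i : 'I_n) : ncoord t i = t i.
Proof. by rewrite /ncoord valK. Qed.

Lemma ncoord_ffun n (s : nat -> K) k : (k < n)%N -> ncoord [ffun i : 'I_n => s i] k = s k.
Proof. by move=> kn; rewrite (ncoord_ord _ (Ordinal kn)) ffunE. Qed.

Lemma ncoord_trunc n (v : nat -> K) j k : (k < n)%N ->
  ncoord (trunc n v j) k = if (k < j)%N then v k else 0.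
Proof. by move=> kn; rewrite (ncoord_ord _ (Ordinal kn)) ffunE. Qed.

Lemma polyfun_ncoord n k : polyfun (@coords K 'I_n) (fun t => ncoord t k).
Proof.
rewrite /ncoord; case: insub => [i|] /=; last exact: polyfun_cst.
exact: (polyfun_gen (@coords K _)).
Qed.

Definition param112 (s : nat -> K) : structures4 :=
  gl_action (unipotent 0 (s 17) (s 16) (s 15) (s 14) (s 13))
    (tabL (s 0) (s 1) (s 2) (s 3) (s 4) (s 5) (s 6) (s 7) (s 8) (s 9) (s 10)
       (s 11) (s 12)).

Definition param12 (s : nat -> K) : structures4 :=
  gl_action (unipotent (s 14) (s 13) (s 12) (s 11) (s 10) (s 9))
    (tabF (s 0) (s 1) (s 2) (s 3) (s 4) (s 5) (s 6) (s 7) (s 8)).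

Definition param112_affine (t : affine K 'I_18) : structures4 := param112 (ncoord t).
Definition param12_affine (t : affine K 'I_15) : structures4 := param12 (ncoord t).

Lemma polyfun_unipotent (T J : Type) (X : J -> T -> K) u12 u13 u14 u23 u24 u34 :
  polyfun X u12 -> polyfun X u13 -> polyfun X u14 -> polyfun X u23 ->
  polyfun X u24 -> polyfun X u34 -> forall i j, polyfun X (fun x =>
    unipotent (u12 x) (u13 x) (u14 x) (u23 x) (u24 x) (u34 x) i j).
Proof.
move=> ? ? ? ? ? ?; apply: ord4P; apply: ord4P; under eq_fun do rewrite !mxE /=;
  by [exact: polyfun_cst |].
Qed.

Lemma polymap_param112 : polymap (@coords K _) param112_affine.
Proof.
apply: polymap_gl_action; first by move=> t; apply: det_unipotent.
  by apply: polyfun_unipotent; first [exact: polyfun_ncoord | exact: polyfun_cst].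
by apply: polymap_tabT; first [exact: polyfun_ncoord | exact: polyfun_cst].
Qed.

Lemma polymap_param12 : polymap (@coords K _) param12_affine.
Proof.
apply: polymap_gl_action; first by move=> t; apply: det_unipotent.
  by apply: polyfun_unipotent; exact: polyfun_ncoord.
apply: polymap_tabT; repeat first [exact: polyfun_ncoord | exact: polyfun_cst
  | apply: polyfunB | apply: polyfunM].
Qed.

(** Adding a multiple of e1 to e2 preserves the shape [tabL], so this factor is absorbed into the
    table and one parameter is saved. *)
Lemma mem_param112 u12 u13 u14 u23 u24 u34 a3 a4 b3 b4 c3 c4 d3 d4 p q r s t :
  range param112_affine (gl_action (unipotent u12 u13 u14 u23 u24 u34)
    (tabL a3 a4 b3 b4 c3 c4 d3 d4 p q r s t)).
Proof.
have UE : unipotent u12 u13 u14 u23 u24 u34 =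
    unipotent 0 u13 u14 u23 u24 u34 *m unipotent u12 0 0 0 0 0.
  apply/matrixP; apply: ord4P; apply: ord4P; rewrite [RHS]mxE sum4 !mxE /=; ring.
rewrite UE -gl_actionK ?unipotent_unit //.
pose T := tabL a3 a4 (b3 - u12 * a3) (b4 - u12 * a4) (c3 - u12 * a3) (c4 - u12 * a4)
  (d3 - u12 * (b3 + c3) + u12 ^+ 2 * a3) (d4 - u12 * (b4 + c4) + u12 ^+ 2 * a4)
  p q (r - u12 * p) (s - u12 * q) t.
have <- : T = gl_action (unipotent u12 0 0 0 0 0)
    (tabL a3 a4 b3 b4 c3 c4 d3 d4 p q r s t).
  have := unipotent_unit u12 0 0 0 0 0.
  by rewrite /T /tabL /unipotent => ?; solve_basis.
pose v := nth 0 [:: a3; a4; b3 - u12 * a3; b4 - u12 * a4; c3 - u12 * a3; c4 - u12 * a4;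
  d3 - u12 * (b3 + c3) + u12 ^+ 2 * a3; d4 - u12 * (b4 + c4) + u12 ^+ 2 * a4;
  p; q; r - u12 * p; s - u12 * q; t; u34; u24; u23; u14; u13].
exists [ffun i : 'I_18 => v i] => //.
by rewrite /param112_affine /param112 !ncoord_ffun.
Qed.

Lemma mem_param12 u12 u13 u14 u23 u24 u34 a2 a3 a4 b3 b4 c3 c4 d4 m :
  range param12_affine (gl_action (unipotent u12 u13 u14 u23 u24 u34)
    (tabF a2 a3 a4 b3 b4 c3 c4 d4 m)).
Proof.
pose v := nth 0 [:: a2; a3; a4; b3; b4; c3; c4; d4; m; u34; u24; u23; u14; u13; u12].
exists [ffun i : 'I_15 => v i] => //.
by rewrite /param12_affine /param12 !ncoord_ffun.
Qed.

Lemma tabL_lower w (a3 a4 b3 b4 c3 c4 d3 d4 p q r s t : K) : is_trig_mx w -> w \in unitmx ->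
  exists x1 x2 x3 x4 x5 x6 x7 x8 x9 x10 x11 x12 x13,
    gl_action (invmx w) (tabL a3 a4 b3 b4 c3 c4 d3 d4 p q r s t) =
    tabL x1 x2 x3 x4 x5 x6 x7 x8 x9 x10 x11 x12 x13.
Proof.
move=> wT wU; set nu := gl_action _ _.
(* Ordinals start at 0: [1 < k] restricts the products to the span of e3 and e4. *)
pose D (i j k : 'I_4) := (maxn i j < k)%N && (1 < k)%N.
have nu0 i j k : ~~ D i j k -> nu (i, j, k) = 0.
  apply: gl_action_inv_support => // [{}i {}j {}k a b c ia jb ck|{}i {}j {}k].
    by rewrite /D => /andP[]; lia.
  by move: i j k; apply: ord4P; apply: ord4P; apply: ord4P => //; rewrite ffunE.
exists (nu (o1, o1, o3)), (nu (o1, o1, o4)), (nu (o1, o2, o3)), (nu (o1, o2, o4)),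
  (nu (o2, o1, o3)), (nu (o2, o1, o4)), (nu (o2, o2, o3)), (nu (o2, o2, o4)),
  (nu (o1, o3, o4)), (nu (o3, o1, o4)), (nu (o2, o3, o4)), (nu (o3, o2, o4)),
  (nu (o3, o3, o4)).
rewrite /tabL -[X in tabT X](nu0 o1 o1 o2) //; apply: tabT_triangular => i j k ijk.
by apply: nu0; rewrite /D; lia.
Qed.

Lemma tabF_lower w (a2 a3 a4 b3 b4 c3 c4 d4 m : K) : is_trig_mx w -> w \in unitmx ->
  exists x1 x2 x3 x4 x5 x6 x7 x8 x9,
    gl_action (invmx w) (tabF a2 a3 a4 b3 b4 c3 c4 d4 m) =
    tabF x1 x2 x3 x4 x5 x6 x7 x8 x9.
Proof.
move=> wT wU; set mu := tabF _ _ _ _ _ _ _ _ _; set nu := gl_action _ _.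
pose D (i j k : 'I_4) := (i + j < k)%N.
have mu0 i j k : ~~ D i j k -> mu (i, j, k) = 0.
  by move: i j k; apply: ord4P; apply: ord4P; apply: ord4P => //; rewrite ffunE.
have nu0 i j k : ~~ D i j k -> nu (i, j, k) = 0.
  apply: gl_action_inv_support mu0 _ _ _ => // {}i {}j {}k a b c ia jb ck.
  by rewrite /D; lia.
have w0 i : w i i != 0 by apply: trig_unit_diag.
(* Coefficients of lowest weight are only rescaled by the diagonal of [w]. Hence (p, q) stays
   proportional to (2 b3 - c3, 2 c3 - b3), with a rescaled [m]. *)
have nuE (i j k : 'I_4) : (i + j).+1 = k :> nat ->
    nu (i, j, k) = w i i * w j j / w k k * mu (i, j, k).
  move=> ijk; apply: (mulfI (w0 k)); rewrite gl_action_inv_extremal //.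
  - by field; apply: w0.
  - move=> a b ia jb ab; apply: mu0; rewrite /D -ijk; apply/negP => abij.
    by case/orP: ab => /eqP; apply; apply: val_inj => /=; lia.
  - by move=> c ck; apply: nu0; rewrite /D; lia.
exists (nu (o1, o1, o2)), (nu (o1, o1, o3)), (nu (o1, o1, o4)), (nu (o1, o2, o3)),
  (nu (o1, o2, o4)), (nu (o2, o1, o3)), (nu (o2, o1, o4)), (nu (o2, o2, o4)),
  (m * w o3 o3 ^+ 2 / (w o4 o4 * w o2 o2)).
rewrite [LHS]tabT_triangular; last by move=> i j k ijk; apply: nu0; rewrite /D; lia.
rewrite /tabF; congr tabT; try (by rewrite nu0);
  by rewrite !nuE // /mu /tabF !ffunE /=; field; rewrite !w0.
Qed.

End Parametrizations.
Arguments ncoord : simpl never.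

(** * Irreducibility and dimension of the two closures *)

Section Dimensions.
Variable K : numClosedFieldType.
Local Notation structures4 := (structures K 4).
Local Notation family112 := (@family112 K).
Local Notation family12 := (@family12 K).

Lemma closure112E : closure family112 = closure (range (@param112_affine K)).
Proof.
apply/seteqP; split.
  apply: closure_sub_closed; first exact: closed_closure.
  move=> _ [l [a [b [c [g gU ->]]]]]; rewrite CD4_112_tabL.
  apply: closure_big_cell gU => w u12 u13 u14 u23 u24 u34 wT wU.
  have [x1 [x2 [x3 [x4 [x5 [x6 [x7 [x8 [x9 [x10 [x11 [x12 [x13 ->]]]]]]]]]]]]] :=
    tabL_lower l 1 0 0 1 b 1 0 a 0 c 0 1 wT wU.
  exact: mem_param112.
apply: closure_sub_closed; first exact: closed_closure.
move=> _ [t _ <-]; apply: closure112_action; first exact: unipotent_unit.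
exact: mem112_tabL.
Qed.

Lemma closure12E : closure family12 = closure (range (@param12_affine K)).
Proof.
apply/seteqP; split.
  apply: closure_sub_closed; first exact: closed_closure.
  move=> _ [a [l [g gU ->]]]; rewrite CD4_12_tabF.
  apply: closure_big_cell gU => w u12 u13 u14 u23 u24 u34 wT wU.
  have [x1 [x2 [x3 [x4 [x5 [x6 [x7 [x8 [x9 ->]]]]]]]]] :=
    tabF_lower 1 0 0 1 0 l 0 a (-1) wT wU.
  exact: mem_param12.
apply: closure_sub_closed; first exact: closed_closure.
move=> _ [t _ <-]; apply: closure12_action; first exact: unipotent_unit.
exact: mem12_tabF.
Qed.

Lemma irreducible_closure112 : irreducible (closure family112).
Proof.
rewrite closure112E; apply: irreducible_closure_image => //.
  by exists [ffun=> 0].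
exact: polymap_param112.
Qed.

Lemma irreducible_closure12 : irreducible (closure family12).
Proof.
rewrite closure12E; apply: irreducible_closure_image => //.
  by exists [ffun=> 0].
exact: polymap_param12.
Qed.

Definition entry (i j k : 'I_4) (mu : structures4) : K := mu (i, j, k).

Lemma polyfun_entry i j k : polyfun (@coords K _) (entry i j k).
Proof. exact: (polyfun_gen (@coords K _)). Qed.

(* The function of index j vanishes at the image of t when the coordinates of *)
(* t of index >= j are 0, but not when only those of index > j are.           *)
Definition test112 : seq (structures4 -> K) :=
  [:: entry o1 o1 o3; entry o1 o1 o4; entry o1 o2 o3; entry o1 o2 o4;
      entry o2 o1 o3; entry o2 o1 o4; entry o2 o2 o3; entry o2 o2 o4;
      entry o1 o3 o4; entry o3 o1 o4; entry o2 o3 o4; entry o3 o2 o4;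
      entry o3 o3 o4; entry o1 o3 o3; entry o1 o1 o2;
      fun mu => entry o1 o1 o2 mu * entry o1 o2 o4 mu - entry o1 o1 o4 mu * entry o1 o2 o2 mu;
      entry o1 o1 o1;
      fun mu => entry o1 o1 o1 mu * entry o1 o2 o4 mu - entry o1 o1 o4 mu * entry o1 o2 o1 mu].

(** The differences of products are minors of the coordinate matrix of e1 e1, e1 e2, e2 e1. While
    the entry of the unipotent matrix to be detected is zero, one column of the minor is a
    combination of the others. *)
Definition test12 : seq (structures4 -> K) :=
  [:: entry o1 o1 o2; entry o1 o1 o3; entry o1 o1 o4; entry o1 o2 o3; entry o1 o2 o4;
      entry o2 o1 o3; entry o2 o1 o4; entry o2 o2 o4; entry o1 o3 o4;
      entry o1 o3 o3; entry o1 o2 o2;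
      fun mu => entry o1 o2 o2 mu * entry o2 o1 o4 mu - entry o1 o2 o4 mu * entry o2 o1 o2 mu;
      entry o1 o1 o1;
      fun mu => entry o1 o1 o1 mu * entry o1 o2 o4 mu - entry o1 o1 o4 mu * entry o1 o2 o1 mu;
      fun mu =>
        entry o1 o1 o1 mu * (entry o1 o2 o3 mu * entry o2 o1 o4 mu - entry o1 o2 o4 mu * entry o2 o1 o3 mu)
        - entry o1 o1 o3 mu * (entry o1 o2 o1 mu * entry o2 o1 o4 mu - entry o1 o2 o4 mu * entry o2 o1 o1 mu)
        + entry o1 o1 o4 mu * (entry o1 o2 o1 mu * entry o2 o1 o3 mu - entry o1 o2 o3 mu * entry o2 o1 o1 mu)].

Lemma unipotent1 : unipotent 0 0 0 0 0 0 = 1%:M :> 'M[K]_4.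
Proof. by apply/matrixP; apply: ord4P; apply: ord4P; rewrite !mxE. Qed.

Section Products.
Variables u12 u13 u14 u23 u24 u34 a2 a3 a4 b3 b4 c3 c4 d3 d4 p q r s t : K.
Local Notation U := (unipotent u12 u13 u14 u23 u24 u34).
Local Notation T := (tabT a2 a3 a4 b3 b4 c3 c4 d3 d4 p q r s t).

Lemma entryE i j k x y : U *m x = delta_mx i 0 -> U *m y = delta_mx j 0 ->
  entry i j k (gl_action U T) = (U *m amul T x y) k 0.
Proof.
move=> ix jy; rewrite /entry ffunE -ix -jy !mulKmx //; exact: unipotent_unit.
Qed.

Lemma unipotent_e1 : U *m vec 1 0 0 0 = delta_mx o1 0.
Proof.
have [-> _ _ _] := delta_vec K; rewrite mx4_vec !vecE; congr vec; ring.
Qed.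

Lemma unipotent_e2 : U *m vec (- u12) 1 0 0 = delta_mx o2 0.
Proof.
have [_ -> _ _] := delta_vec K; rewrite mx4_vec !vecE; congr vec; ring.
Qed.

Lemma entry11 k : entry o1 o1 k (gl_action U T) =
  vec (a2 * u12 + a3 * u13 + a4 * u14) (a2 + a3 * u23 + a4 * u24) (a3 + a4 * u34) a4 k 0.
Proof.
rewrite (entryE _ unipotent_e1 unipotent_e1) amul_tabT mx4_vec !vecE.
by congr (vec _ _ _ _ _ _); ring.
Qed.

Lemma entry12 k : entry o1 o2 k (gl_action U T) =
  vec (b3 * u13 + b4 * u14 - u12 * (a2 * u12 + a3 * u13 + a4 * u14))
    (b3 * u23 + b4 * u24 - u12 * (a2 + a3 * u23 + a4 * u24))
    (b3 + b4 * u34 - u12 * (a3 + a4 * u34)) (b4 - u12 * a4) k 0.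
Proof.
rewrite (entryE _ unipotent_e1 unipotent_e2) amul_tabT mx4_vec !vecE.
by congr (vec _ _ _ _ _ _); ring.
Qed.

Lemma entry21 k : entry o2 o1 k (gl_action U T) =
  vec (c3 * u13 + c4 * u14 - u12 * (a2 * u12 + a3 * u13 + a4 * u14))
    (c3 * u23 + c4 * u24 - u12 * (a2 + a3 * u23 + a4 * u24))
    (c3 + c4 * u34 - u12 * (a3 + a4 * u34)) (c4 - u12 * a4) k 0.
Proof.
rewrite (entryE _ unipotent_e2 unipotent_e1) amul_tabT mx4_vec !vecE.
by congr (vec _ _ _ _ _ _); ring.
Qed.

End Products.

Lemma entry13 u34 a2 a3 a4 b3 b4 c3 c4 d3 d4 p q r s t :
  entry o1 o3 o3 (gl_action (unipotent 0 0 0 0 0 u34)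
    (tabT a2 a3 a4 b3 b4 c3 c4 d3 d4 p q r s t)) = p * u34.
Proof.
have e3 : unipotent 0 0 0 0 0 u34 *m vec 0 0 1 0 = delta_mx o3 0.
  have [_ _ -> _] := delta_vec K; rewrite mx4_vec !vecE; congr vec; ring.
rewrite (entryE _ _ _ _ _ _ _ _ _ _ _ _ _ _ _ (unipotent_e1 _ _ _ _ _ _) e3).
rewrite amul_tabT mx4_vec !vecE !mxE /=; ring.
Qed.

Local Ltac kill_coords t0 :=
  try rewrite (t0 17%N isT isT); try rewrite (t0 16%N isT isT);
  try rewrite (t0 15%N isT isT); try rewrite (t0 14%N isT isT);
  try rewrite (t0 13%N isT isT); try rewrite (t0 12%N isT isT);
  try rewrite (t0 11%N isT isT); try rewrite (t0 10%N isT isT);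
  try rewrite (t0 9%N isT isT); try rewrite (t0 8%N isT isT);
  try rewrite (t0 7%N isT isT); try rewrite (t0 6%N isT isT);
  try rewrite (t0 5%N isT isT); try rewrite (t0 4%N isT isT);
  try rewrite (t0 3%N isT isT); try rewrite (t0 2%N isT isT);
  try rewrite (t0 1%N isT isT); try rewrite (t0 0%N isT isT).
Local Ltac compute_entries :=
  first [rewrite unipotent1 gl_action1 /entry !ffunE /=
    | rewrite entry13 | rewrite ?entry11 ?entry12 ?entry21 !mxE /=].
Local Ltac solve_nonzero :=
  first [by rewrite ?oner_eq0 ?pnatr_eq0
    | match goal with |- is_true (?X != 0) =>
        first [have -> : X = 1 by ring | have -> : X = 2 by ring | have -> : X = -1 by ring]
      end; by rewrite ?oppr_eq0 ?oner_eq0 ?pnatr_eq0].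

Lemma krull_dimension112 : krull_dimension (closure family112) 18.
Proof.
split; last first.
  by move=> m; apply: irreducible_chain_le closure112E; exact: polymap_param112.
(* Index 3 is b4. With all parameters equal to 1 the minors of e1 e1 and e1 e2 would vanish. *)
pose v (k : nat) : K := if k == 3%N then 2 else 1.
apply: (irreducible_chain_image (v := v) (f := nth (fun=> 0) test112)
  (polymap_param112 K) closure112E).
- move=> j _; do 18![case: j => [|j] /=; first by
    repeat first [exact: polyfun_entry | apply: polyfunB | apply: polyfunM]].
  by rewrite nth_nil; apply: polyfun_cst.
- move=> j t j18 t0; have {}t0 k : (j <= k)%N -> (k < 18)%N -> ncoord t k = 0.
    by move=> jk k18; rewrite (ncoord_ord t (Ordinal k18)) t0.
  rewrite /param112_affine /param112 /tabL.
  case: j j18 t0 => [|[|[|[|[|[|[|[|[|[|[|[|[|[|[|[|[|[|j]]]]]]]]]]]]]]]]]] // j18 t0 /=;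
    kill_coords t0; compute_entries; ring.
- move=> j j18; rewrite /param112_affine /param112 /tabL.
  case: j j18 => [|[|[|[|[|[|[|[|[|[|[|[|[|[|[|[|[|[|j]]]]]]]]]]]]]]]]]] // j18;
    rewrite !ncoord_trunc //= /v /=; compute_entries; solve_nonzero.
Qed.

Lemma krull_dimension12 : krull_dimension (closure family12) 15.
Proof.
split; last first.
  by move=> m; apply: irreducible_chain_le closure12E; exact: polymap_param12.
(* Here b4 has index 4. *)
pose v (k : nat) : K := if k == 4%N then 2 else 1.
apply: (irreducible_chain_image (v := v) (f := nth (fun=> 0) test12)
  (polymap_param12 K) closure12E).
- move=> j _; do 15![case: j => [|j] /=; first by
    repeat first [exact: polyfun_entry | apply: polyfunB | apply: polyfunD
      | apply: polyfunM]].
  by rewrite nth_nil; apply: polyfun_cst.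
- move=> j t j15 t0; have {}t0 k : (j <= k)%N -> (k < 15)%N -> ncoord t k = 0.
    by move=> jk k15; rewrite (ncoord_ord t (Ordinal k15)) t0.
  rewrite /param12_affine /param12 /tabF.
  case: j j15 t0 => [|[|[|[|[|[|[|[|[|[|[|[|[|[|[|j]]]]]]]]]]]]]]] // j15 t0 /=;
    kill_coords t0; compute_entries; ring.
- move=> j j15; rewrite /param12_affine /param12 /tabF.
  case: j j15 => [|[|[|[|[|[|[|[|[|[|[|[|[|[|[|j]]]]]]]]]]]]]]] // j15;
    rewrite !ncoord_trunc //= /v /=; compute_entries; solve_nonzero.
Qed.

Lemma irreducible_chain_sub (X Y : set structures4) m : closed X -> X `<=` Y ->
  irreducible_chain X m -> irreducible_chain Y m.
Proof.
move=> cX XY [F [Fcl Flt]]; exists F; split=> // i /Fcl[[G cG FE] Firr]; split=> //.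
exists (X `&` G); first exact: closedI.
by rewrite FE setIA (setIidr XY).
Qed.

Lemma closure112_not_sub : ~ closure family112 `<=` closure family12.
Proof.
move=> sub; have [chain _] := krull_dimension112.
have [_ /(_ 18)] := krull_dimension12.
suff c18 : irreducible_chain (closure family12) 18 by move=> /(_ c18).
by apply: irreducible_chain_sub chain; first exact: closed_closure.
Qed.

(* A A has dimension at most 2 on the first component. *)
Lemma closure12_not_sub : ~ closure family12 `<=` closure family112.
Proof.
pose f (mu : structures4) :=
  entry o1 o1 o2 mu * (entry o1 o2 o3 mu * entry o2 o1 o4 mu - entry o1 o2 o4 mu * entry o2 o1 o3 mu)
  - entry o1 o1 o3 mu * (entry o1 o2 o2 mu * entry o2 o1 o4 mu - entry o1 o2 o4 mu * entry o2 o1 o2 mu)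
  + entry o1 o1 o4 mu * (entry o1 o2 o2 mu * entry o2 o1 o3 mu - entry o1 o2 o3 mu * entry o2 o1 o2 mu).
have fP : polyfun (@coords K _) f.
  by repeat first [exact: polyfun_entry | apply: polyfunB | apply: polyfunD
      | apply: polyfunM].
(* In this algebra e1 e1 = e2, e1 e2 = e3 and e2 e1 = e4, so the minor [f] equals 1. *)
move=> sub; have := sub _ (@mem12_tabF K 1 0 0 1 0 0 1 0 0); rewrite closure112E.
move=> /closureP /(_ f fP); rewrite /f /entry /tabF !ffunE /= => H.
suff : (1 : K) = 0 by move/eqP; rewrite oner_eq0.
rewrite -[RHS]H; first by ring.
move=> _ [t _ <-]; rewrite /param112_affine /param112 /tabL -!/(entry _ _ _ _).
by rewrite !(entry11, entry12, entry21) !mxE /=; ring.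
Qed.

End Dimensions.

(** * The irreducible components *)

Lemma family112E (K : numClosedFieldType) : (\bigcup_(lambda : K) \bigcup_(alpha : K)
    \bigcup_(beta : K) \bigcup_(gamma : K)
      gl_orbit (CD4_112 lambda alpha beta gamma)) = @family112 K.
Proof.
apply/seteqP; split=> [mu [l _ [a _ [b _ [g _ H]]]]|mu [l [a [b [g H]]]]].
  by exists l, a, b, g.
by exists l => //; exists a => //; exists b => //; exists g.
Qed.

Lemma family12E (K : numClosedFieldType) : (\bigcup_(lambda : K) \bigcup_(alpha : K)
    gl_orbit (CD4_12 alpha lambda)) = @family12 K.
Proof.
apply/seteqP; split=> [mu [l _ [a _ H]]|mu [a [l H]]]; first by exists a, l.
by exists l => //; exists a.
Qed.

Lemma irreducible_components_setU2 (T : topologicalType) (X A B : set T) :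
  closed A -> closed B -> irreducible A -> irreducible B ->
  X = A `|` B -> ~ A `<=` B -> ~ B `<=` A ->
  [set Z | irreducible_component X Z] = [set A; B].
Proof.
move=> cA cB iA iB XE AB BA.
have AX : A `<=` X by rewrite XE; apply: subsetUl.
have BX : B `<=` X by rewrite XE; apply: subsetUr.
have closedX C : closed C -> C `<=` X -> closed_in X C.
  by move=> cC CX; exists C => //; apply/esym/setIidr.
have cover G : closed_in X G -> irreducible G -> G `<=` A \/ G `<=` B.
  move=> [G' _ GE] [_ /(_ A B cA cB)]; apply.
  by rewrite GE -XE; apply: subIsetl.
apply/seteqP; split=> Z /=.
  move=> [cZ iZ maxZ]; have [ZA|ZB] := cover Z cZ iZ.
    by left; rewrite (maxZ A) //; apply: closedX.
  by right; rewrite (maxZ B) //; apply: closedX.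
case=> ->; split=> //; try exact: closedX.
- move=> G cG iG AG; have [GA|GB] := cover G cG iG; first exact/seteqP.
  by case: AB; apply: subset_trans AG GB.
- move=> G cG iG BG; have [GA|GB] := cover G cG iG; last exact/seteqP.
  by case: BA; apply: subset_trans BG GA.
Qed.

Lemma nilpotent_CD_components (K : numClosedFieldType) :
  [set Z | irreducible_component (nilpotent_CD K 4) Z] =
  [set closure (@family112 K); closure (@family12 K)].
Proof.
apply: irreducible_components_setU2.
- exact: closed_closure.
- exact: closed_closure.
- exact: irreducible_closure112.
- exact: irreducible_closure12.
- apply/seteqP; split; first exact: nilpotent_CD_sub.
  by move=> mu [/closure112_nilpotent_CD|/closure12_nilpotent_CD].
- exact: closure112_not_sub.
- exact: closure12_not_sub.
Qed.

Theorem theorem2 (R : realType) :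
  let C : fieldType := R[i] in
  let N : set (structures C 4) := nilpotent_CD C 4 in
  let C1 : set (structures C 4) :=
    closure (\bigcup_(lambda : C) \bigcup_(alpha : C)
             \bigcup_(beta : C) \bigcup_(gamma : C)
               gl_orbit (CD4_112 lambda alpha beta gamma))%classic in
  let C2 : set (structures C 4) :=
    closure (\bigcup_(lambda : C) \bigcup_(alpha : C)
               gl_orbit (CD4_12 alpha lambda))%classic in
  [/\ [set Z | irreducible_component N Z]%classic = [set C1; C2]%classic,
      C1 <> C2,
      krull_dimension C1 18 &
      krull_dimension C2 15].
Proof.
move=> C N C1 C2; pose K : numClosedFieldType := R[i].
have C1E : C1 = closure (@family112 K) by rewrite /C1 -family112E.
have C2E : C2 = closure (@family12 K) by rewrite /C2 -family12E.
split.
- by rewrite C1E C2E; apply: (nilpotent_CD_components K).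
- rewrite C1E C2E => C12; apply: (@closure12_not_sub K).
  by rewrite C12.
- by rewrite C1E; apply: (krull_dimension112 K).
- by rewrite C2E; apply: (krull_dimension12 K).
Qed.
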